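(* Let $F$ be a bipartite graph that is not a star and whose color surplus satisfies $\sigma(F)=|F|-\alpha(F)$. Then for all sufficiently large $m$, if $G$ is an $F$-free graph with $m$ edges, then $\lambda(G)\le\lambda(S_{\sigma(F)-1,m})$, with equality if and only if $G=S_{\sigma(F)-1,m}$.
   Context: All graphs are finite and simple; isolated vertices are ignored. $|F|$ is the number of vertices and $\alpha(F)$ the independence number of $F$. The color surplus $\sigma(F)$ of a bipartite graph $F$ is the minimum size of a color class over all proper $2$-colorings of $F$. Split graph: for $1\le k<m$, write $m-\binom{k}{2}=kt+s$ with integers $t\ge 1$ and $0\le s\le k-1$; $S_{k,m}$ is the $m$-edge graph obtained from $K_k\vee tK_1$ (a clique $K_k$ joined to $t$ independent vertices) by adding one extra vertex adjacent to exactly $s$ vertices of the $K_k$. $\lambda(G)$ is the spectral radius of the adjacency matrix; $F$-free means no subgraph isomorphic to $F$. *)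

(* Defs.v *)
From HB Require Import structures.
From mathcomp Require Import all_boot all_order all_algebra.
From mathcomp Require Import classical_sets reals.
Set Implicit Arguments. Unset Strict Implicit. Unset Printing Implicit Defensive.
Import Order.TTheory GRing.Theory Num.Theory.

(* A (simple) graph is a symmetric irreflexive relation E on a finType V.
   Following the paper, isolated vertices are ignored: the vertex set
   "V(G)" is the set of non-isolated vertices. *)
Definition simple_graph (V : finType) (E : rel V) : Prop :=
  symmetric E /\ irreflexive E.

Definition nonisol (V : finType) (E : rel V) (x : V) : bool := [exists y, E x y].

Definition order_g (V : finType) (E : rel V) : nat := #|[set x | nonisol E x]|.

Definition nedges (V : finType) (E : rel V) : nat :=
  #|[set e : {set V} | [exists x, exists y, E x y && (e == [set x; y])]]|.

Definition independent (V : finType) (E : rel V) (S : {set V}) : bool :=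
  [forall x in S, forall y in S, ~~ E x y].

Definition alpha (V : finType) (E : rel V) : nat :=
  \max_(S : {set V} | (S \subset [set x | nonisol E x]) && independent E S) #|S|.

Definition proper2 (V : finType) (E : rel V) (c : {ffun V -> bool}) : bool :=
  [forall x, forall y, E x y ==> (c x != c y)].

Definition bipartite (V : finType) (E : rel V) : Prop :=
  exists c : {ffun V -> bool}, proper2 E c.

Definition sigma (V : finType) (E : rel V) : nat :=
  \big[minn/#|V|]_(c : {ffun V -> bool} | proper2 E c)
     minn #|[set x | nonisol E x & c x]| #|[set x | nonisol E x & ~~ c x]|.

Definition is_star (V : finType) (E : rel V) : Prop :=
  exists v : V, forall x y, E x y -> x = v \/ y = v.

Definition subgraph (VF : finType) (EF : rel VF) (V : finType) (E : rel V) : Prop :=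
  exists f : VF -> V,
    (forall x y, nonisol EF x -> nonisol EF y -> f x = f y -> x = y) /\
    (forall x y, EF x y -> E (f x) (f y)).

Definition F_free (VF : finType) (EF : rel VF) (V : finType) (E : rel V) : Prop :=
  ~ subgraph EF E.

Definition isomorphic (V : finType) (E : rel V) (W : finType) (E' : rel W) : Prop :=
  exists f : V -> W,
    (forall x y, nonisol E x -> nonisol E y -> f x = f y -> x = y) /\
    (forall x, nonisol E x -> nonisol E' (f x)) /\
    (forall z, nonisol E' z -> exists x, nonisol E x /\ f x = z) /\
    (forall x y, nonisol E x -> nonisol E y -> E x y = E' (f x) (f y)).

Definition adj (R : realType) (V : finType) (E : rel V) : 'M[R]_#|V| :=
  \matrix_(i, j) ((E (enum_val i) (enum_val j))%:R)%R.

Local Open Scope classical_set_scope.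
Definition lambda (R : realType) (V : finType) (E : rel V) : R :=
  sup [set (`|a|)%R | a in [set a : R | eigenvalue (adj R E) a]].
Local Close Scope classical_set_scope.

(* Split graph S_{k,m}: write m - C(k,2) = k t + s with 0 <= s <= k-1.
   Vertices 0..k-1 form a clique K_k, vertices k..k+t-1 are independent and
   joined to the clique, and vertex k+t is adjacent to clique vertices
   0..s-1. *)
Definition split_t (k m : nat) : nat := (m - 'C(k, 2)) %/ k.
Definition split_s (k m : nat) : nat := (m - 'C(k, 2)) %% k.
Definition split_n (k m : nat) : nat := k + split_t k m + 1.

Definition split_adj0 (k t s : nat) (x y : nat) : bool :=
  [|| (x < k) && (y < k),
      (x < k) && (k <= y < k + t)
    | (x < s) && (y == k + t)].

Definition split_graph (k m : nat) : rel 'I_(split_n k m) :=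
  fun x y => (x != y) &&
    (split_adj0 k (split_t k m) (split_s k m) x y ||
     split_adj0 k (split_t k m) (split_s k m) y x).
Arguments split_graph k m : clear implicits.

(* Main.v *)
Require Import Defs.
From HB Require Import structures.
From mathcomp Require Import boolp classical_sets reals.
From mathcomp Require Import all_boot all_order all_algebra.
From mathcomp Require Import ring lra zify.
Set Implicit Arguments. Unset Strict Implicit. Unset Printing Implicit Defensive.
Import Order.TTheory GRing.Theory Num.Theory.
Local Open Scope ring_scope.

(** Put [k = sigma F - 1] and [b = |F|].  An [F]-free graph [G] contains no
    [K_{k+1,b}], and this is all that is used.  Assume
    [l = lambda G >= lambda (S_{k,m})], so that [l^2 - (k-1) l >= m - O(1)], and
    let [x] be a Perron vector with maximum [x_u = 1].

    - Cauchy-Schwarz over the edges shows that the weights [x_v^2] span edge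
      density bounded below, and a greedy choice of [k+1] vertices then
      contradicts [K_{k+1,b}]-freeness unless the norm of [x] is bounded; hence
      [L = {v : x_v >= 1/3}] has bounded size.
    - Comparing [l^2 - (k-1) l], expanded at [u], with the number of edges
      bounds a sum of nonnegative terms.  It follows that [|L| = k], that
      [x = 1 - O(l^-2)] on [L] and [x = O(1/l)] elsewhere, that only [O(1)]
      edges avoid [L], and that only [O(l)] vertices are joined to some but not
      to all of [L].
    - Moving [x] from [L] to the clique of [S_{k,m}] and choosing the other
      entries optimally, the Rayleigh quotient of [S_{k,m}] exceeds [l] unless
      an integer defect vanishes, and the defect vanishes only for [S_{k,m}]. *)

(** * Symmetric forms and the spectral radius *)

(** The spectral radius of [S_{k,m}] is never computed. For given clique entries, an outer vertex
    with neighbour sum [g] contributes at most the maximum of [2 y g - l y^2], namely [g^2 / l].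
    Eliminating the outer entries of both graphs in this way leaves a comparison of sums of [g^2].
    To leading order [g] is the number [d] of neighbours in [L], and the edge count controls the sum
    of the [d]. Convexity favours [d = k]: a vertex loses [d (k - d)], an edge outside [L] loses
    [k], and an edge missing inside [L] loses order [l]. These losses are integral up to the last
    kind, while all errors are [O(1/l)]; hence a large [l] decides. The obstacle is that there may
    be order [l^2] outer vertices. Entries on [L] must therefore be known to within [O(l^-2)], and
    the full outer vertices must cancel between the two graphs until only [O(l)] remain, which is
    why the partially joined vertices have to be counted. *)

Lemma sum_cauchy_schwarz (R : realFieldType) (I : finType) (f g : I -> R) :
  (\sum_i f i * g i) ^+ 2 <= (\sum_i f i ^+ 2) * (\sum_i g i ^+ 2).
Proof.
have H : 0 <= \sum_i \sum_j (f i * g j - f j * g i) ^+ 2.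
  by apply: sumr_ge0 => i _; apply: sumr_ge0 => j _; exact: sqr_ge0.
have E1 : \sum_i \sum_j (f i ^+ 2 * g j ^+ 2) =
  (\sum_i f i ^+ 2) * (\sum_i g i ^+ 2) by rewrite big_distrlr.
have E2 : \sum_i \sum_j (f j ^+ 2 * g i ^+ 2) =
  (\sum_i f i ^+ 2) * (\sum_i g i ^+ 2) by rewrite exchange_big big_distrlr.
have E3 : \sum_i \sum_j ((f i * g i) * (f j * g j)) = (\sum_i f i * g i) ^+ 2.
  by rewrite expr2 big_distrlr.
have E4 : \sum_i \sum_j (f i * g j - f j * g i) ^+ 2 =
   \sum_i \sum_j (f i ^+ 2 * g j ^+ 2) + \sum_i \sum_j (f j ^+ 2 * g i ^+ 2)
   - 2 * \sum_i \sum_j ((f i * g i) * (f j * g j)).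
  rewrite big_distrr -sumrN -!big_split; apply: eq_bigr => i _ /=.
  rewrite big_distrr -sumrN -!big_split; apply: eq_bigr => j _ /=; ring.
rewrite E4 E1 E2 E3 in H; lra.
Qed.

Definition normsq (R : realType) (T : finType) (y : T -> R) : R :=
  \sum_v y v ^+ 2.

Definition qform (R : realType) (T : finType) (a : T -> T -> R) (y : T -> R) : R :=
  \sum_v \sum_w a v w * (y v * y w).

Section SymmetricForms.
Variables (R : realType) (T : finType) (a : T -> T -> R).
Hypothesis asym : forall v w, a v w = a w v.
Hypothesis age0 : forall v w, 0 <= a v w.

Lemma normsq_ge0 (y : T -> R) : 0 <= normsq y.
Proof. by apply: sumr_ge0 => i _; exact: sqr_ge0. Qed.

Lemma le_normsq (y : T -> R) v : y v ^+ 2 <= normsq y.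
Proof.
rewrite /normsq (bigD1 v) //= lerDl.
by apply: sumr_ge0 => i _; exact: sqr_ge0.
Qed.

Lemma normsq_gt0 (y : T -> R) v : y v != 0 -> 0 < normsq y.
Proof. by move=> yv; apply: lt_le_trans (le_normsq y v); rewrite exprn_even_gt0. Qed.

Lemma normsq_eq0 (y : T -> R) v : normsq y <= 0 -> y v = 0.
Proof.
by move=> H; apply/eqP/negPn/negP => /normsq_gt0; rewrite ltNge H.
Qed.

Lemma qform_abs (y : T -> R) :
  `|qform a y| <= qform a (fun v => `|y v|).
Proof.
apply: (le_trans (ler_norm_sum _ _ _)); apply: ler_sum => v _.
apply: (le_trans (ler_norm_sum _ _ _)); apply: ler_sum => w _.
by rewrite !normrM (ger0_norm (age0 _ _)).
Qed.

Lemma normsq_abs (y : T -> R) : normsq (fun v => `|y v|) = normsq y.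
Proof. by apply: eq_bigr => v _; rewrite real_normK ?num_real. Qed.

Lemma qform_bound (y : T -> R) :
  `|qform a y| <= (\sum_v \sum_w a v w) * normsq y.
Proof.
apply: (le_trans (qform_abs y)); rewrite big_distrl; apply: ler_sum => v _ /=.
rewrite big_distrl; apply: ler_sum => w _ /=; apply: ler_wpM2l => //.
have Hv := le_normsq y v; have Hw := le_normsq y w.
rewrite -normrM; have : 0 <= (y v - y w) ^+ 2 by exact: sqr_ge0.
have : 0 <= (y v + y w) ^+ 2 by exact: sqr_ge0.
move=> *; rewrite ler_norml; apply/andP; split; nra.
Qed.

Definition apply_form (y : T -> R) (v : T) : R := \sum_w a v w * y w.

Lemma qformE y : qform a y = \sum_v y v * apply_form y v.
Proof.
apply: eq_bigr => v _; rewrite big_distrr; apply: eq_bigr => w _ /=; ring.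
Qed.

Lemma apply_form_sym y z :
  \sum_v z v * apply_form y v = \sum_v y v * apply_form z v.
Proof.
rewrite /apply_form; under eq_bigr do rewrite big_distrr.
rewrite exchange_big; apply: eq_bigr => v _; rewrite big_distrr /=.
by apply: eq_bigr => w _; rewrite asym; ring.
Qed.

Lemma qform_sub y z t :
  qform a (fun v => y v - t * z v) =
  qform a y - 2 * t * (\sum_v z v * apply_form y v) + t ^+ 2 * qform a z.
Proof.
have -> : 2 * t * (\sum_v z v * apply_form y v) =
  t * (\sum_v z v * apply_form y v) + t * (\sum_v y v * apply_form z v).
  by rewrite -apply_form_sym; ring.
rewrite !qformE !big_distrr /= opprD addrA -!sumrN -!big_split /=.
apply: eq_bigr => v _.
have -> : apply_form (fun v0 => y v0 - t * z v0) v =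
   apply_form y v - t * apply_form z v.
  rewrite /apply_form big_distrr -sumrN -big_split.
  by apply: eq_bigr => w _ /=; ring.
ring.
Qed.

(* With z = (mu - a) y, the inequality is the nonnegativity of the form at
   y - z / K. *)
Lemma residual_bound mu :
  (forall y, qform a y <= mu * normsq y) ->
  exists2 K, 0 < K & forall y : T -> R,
    normsq (fun v => mu * y v - apply_form y v) <= K * (mu * normsq y - qform a y).
Proof.
move=> psd; set C := \sum_v \sum_w a v w.
have C0 : 0 <= C by apply: sumr_ge0 => v _; apply: sumr_ge0.
exists (`|mu| + C + 1); first by have := normr_ge0 mu; lra.
set K := _ + 1; have K0 : 0 < K by rewrite /K; have := normr_ge0 mu; lra.
move=> y; set z := (fun v => _).
have Hz : mu * normsq z - qform a z <= K * normsq z.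
  have := qform_bound z; rewrite -/C ler_norml => /andP[H _].
  have := normsq_ge0 z; have := ler_norm mu; rewrite /K; nra.
have := psd (fun v => y v - K^-1 * z v).
rewrite qform_sub.
have -> : normsq (fun v => y v - K^-1 * z v) =
  normsq y - 2 * K^-1 * (\sum_v z v * y v) + K^-1 ^+ 2 * normsq z.
  rewrite /normsq !big_distrr -sumrN -!big_split; apply: eq_bigr => v _ /=; ring.
have E1 : normsq z = mu * (\sum_v z v * y v) - \sum_v z v * apply_form y v.
  rewrite /normsq big_distrr -sumrN -big_split; apply: eq_bigr => v _ /=.
  rewrite expr2 {2}/z; ring.
set P := \sum_v z v * y v in E1 *; set Q := \sum_v _ * _ in E1 *.
set i := K^-1 => H.
have iK : i * K = 1 by rewrite /i mulVf // gt_eqF.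
have i0 : 0 < i by rewrite /i invr_gt0.
have H2 : 0 <= mu * normsq y - qform a y - 2 * i * normsq z
  + i ^+ 2 * (mu * normsq z - qform a z) by rewrite {1}E1; lra.
have H3 : i ^+ 2 * (mu * normsq z - qform a z) <= i * normsq z.
  have -> : i * normsq z = i ^+ 2 * (K * normsq z) by rewrite -[LHS]mul1r -iK; ring.
  by apply: ler_wpM2l => //; exact: sqr_ge0.
have H4 : i * normsq z <= mu * normsq y - qform a y by lra.
have := ler_wpM2l (ltW K0) H4.
by rewrite mulrA [K * i]mulrC iK mul1r.
Qed.

End SymmetricForms.

(** The matrix is invertible and [D] is the squared Frobenius norm of its inverse, plus one for
    strict positivity. This bound replaces compactness of the unit sphere in [top_eigenvector]. *)
Lemma injective_coercive (R : realType) (T : finType) (c : T -> T -> R) :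
  (forall v w, c v w = c w v) ->
  (forall y, (forall v, apply_form c y v = 0) -> forall v, y v = 0) ->
  exists2 D, 0 < D & forall y, normsq y <= D * normsq (apply_form c y).
Proof.
move=> csym inj.
pose M : 'M[R]_#|T| := \matrix_(i, j) c (enum_val i) (enum_val j).
pose row_of (y : T -> R) : 'rV[R]_#|T| := \row_i y (enum_val i).
have mulM y : row_of y *m M = row_of (apply_form c y).
  apply/rowP => j; rewrite !mxE /apply_form.
  rewrite (reindex (@enum_val _ T)) /=; last first.
    by exists enum_rank => i _; rewrite ?enum_valK ?enum_rankK.
  by apply: eq_bigr => i _; rewrite !mxE csym mulrC.
have unitM : M \in unitmx.
  rewrite -row_free_unit -kermx_eq0; apply/eqP/row_matrixP => i.
  rewrite row0; set r := row i _.
  have rM : r *m M = 0 by apply/sub_kermxP; exact: row_sub.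
  pose y v := r 0 (enum_rank v).
  have ry : row_of y = r by apply/rowP => j; rewrite mxE /y enum_valK.
  have y0 : forall v, y v = 0.
    apply: inj => v; move: (mulM y); rewrite ry rM => /rowP/(_ (enum_rank v)).
    by rewrite !mxE enum_rankK.
  by apply/rowP => j; rewrite -[j]enum_valK -/(y _) y0 mxE.
pose D := \sum_i \sum_j (invmx M i j) ^+ 2.
have D0 : 0 <= D by do 2 (apply: sumr_ge0 => ? _); exact: sqr_ge0.
exists (D + 1) => [|y]; first by lra.
suff H : normsq y <= D * normsq (apply_form c y).
  by have := normsq_ge0 (apply_form c y); lra.
have -> : normsq y = \sum_i (row_of y 0 i) ^+ 2.
  rewrite /normsq (reindex (@enum_val _ T)) /=; last first.
    by exists enum_rank => i _; rewrite ?enum_valK ?enum_rankK.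
  by apply: eq_bigr => i _; rewrite mxE.
have -> : normsq (apply_form c y) = \sum_i (row_of (apply_form c y) 0 i) ^+ 2.
  rewrite /normsq (reindex (@enum_val _ T)) /=; last first.
    by exists enum_rank => i _; rewrite ?enum_valK ?enum_rankK.
  by apply: eq_bigr => i _; rewrite mxE.
rewrite -mulM -{1}[row_of y](mulmxK unitM); set z := _ *m M.
rewrite /D exchange_big big_distrl; apply: ler_sum => j _ /=.
rewrite mxE; apply: le_trans (sum_cauchy_schwarz _ _) _.
by rewrite mulrC.
Qed.

Section TopEigenvector.
Variables (R : realType) (T : finType) (a : T -> T -> R).
Hypothesis asym : forall v w, a v w = a w v.
Hypothesis age0 : forall v w, 0 <= a v w.

(** [mu] is the supremum of the Rayleigh quotients. Were [mu - a] injective, coercivity and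
    [residual_bound] would keep every quotient away from [mu]. So there is a kernel vector, and
    since [a] is nonnegative its absolute value is again a maximiser. *)
Lemma top_eigenvector : (0 < #|T|)%N ->
  exists mu : R, exists x : T -> R,
  [/\ forall y, qform a y <= mu * normsq y,
      forall v, 0 <= x v, exists v, 0 < x v &
      forall v, apply_form a x v = mu * x v].
Proof.
case/card_gt0P => v0 _.
pose S := [set r : R | exists2 y : T -> R, 0 < normsq y & qform a y = r * normsq y]%classic.
have ubS : has_ubound S.
  exists (\sum_v \sum_w a v w) => r [y y0 yr].
  have := qform_bound age0 y; rewrite ler_norml yr => /andP[_].
  by rewrite ler_pM2r.
have neS : (S !=set0)%classic.
  pose y v : R := (v == v0)%:R.
  have y0 : 0 < normsq y by apply: (@normsq_gt0 _ _ _ v0); rewrite /y eqxx oner_eq0.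
  exists (qform a y / normsq y); exists y => //.
  by rewrite divfK // gt_eqF.
set mu := sup S.
have psd y : qform a y <= mu * normsq y.
  have [y0|/negPf y0] := boolP (0 < normsq y).
    have : qform a y / normsq y <= mu.
      by apply: ub_le_sup => //; exists y => //; rewrite divfK // gt_eqF.
    by rewrite ler_pdivrMr.
  have y00 : normsq y = 0.
    by apply/eqP; rewrite eq_le normsq_ge0 leNgt y0.
  rewrite y00 mulr0 /qform big1 // => v _; rewrite big1 // => w _.
  by rewrite (@normsq_eq0 _ _ y v) ?y00 // mul0r mulr0.
have [K K0 HK] := residual_bound asym age0 psd.
pose c v w := mu * (v == w)%:R - a v w.
have cE y v : apply_form c y v = mu * y v - apply_form a y v.
  rewrite /apply_form /c.
  under eq_bigr do rewrite mulrBl.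
  rewrite big_split sumrN /=; congr (_ - _).
  rewrite (bigD1 v) //= eqxx mulr1 big1 ?addr0 // => w /negPf wv.
  by rewrite eq_sym wv mulr0 mul0r.
have [inj|] := pselect (forall y, (forall v, apply_form c y v = 0) -> forall v, y v = 0).
  have csym v w : c v w = c w v by rewrite /c asym eq_sym.
  have [D D0 HD] := injective_coercive csym inj.
  exfalso.
  (* Coercivity forces [mu - r >= 1 / (D K)] for every quotient [r]; some quotient comes within half
     of that gap. *)
  have [] := sup_adherent (_ : 0 < (2 * (D * K))^-1) (conj neS ubS).
    by rewrite invr_gt0 !mulr_gt0.
  move=> r [y y0 yr]; rewrite -/mu => mur.
  have := HD y.
  have -> : normsq (apply_form c y) = normsq (fun v => mu * y v - apply_form a y v).
    by apply: eq_bigr => v _; rewrite cE.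
  have := HK y; rewrite yr => H1 H2.
  have H3 : normsq y <= D * (K * (mu * normsq y - r * normsq y)).
    by apply: le_trans H2 _; rewrite ler_pM2l.
  have H4 : 1 <= D * K * (mu - r).
    by rewrite -(ler_pM2r y0); lra.
  have H5 : mu - r < (2 * (D * K))^-1 by lra.
  have DK : 0 < D * K by rewrite mulr_gt0.
  have : D * K * (mu - r) < D * K * (2 * (D * K))^-1 by rewrite ltr_pM2l.
  have -> : D * K * (2 * (D * K))^-1 = 2^-1 by field; rewrite !gt_eqF.
  lra.
move=> /existsNP[y /not_implyP[cy0 /existsNP[v1 yv1]]].
pose x v := `|y v|.
exists mu, x; split=> //; first by move=> v; rewrite normr_ge0.
  by exists v1; rewrite normr_gt0; apply/eqP.
have ey v : apply_form a y v = mu * y v.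
  by have := cy0 v; rewrite cE => H; lra.
have qy : qform a y = mu * normsq y.
  rewrite qformE /normsq big_distrr; apply: eq_bigr => v _; rewrite ey /=; ring.
have nx : normsq x = normsq y by exact: normsq_abs.
have qx : mu * normsq x <= qform a x.
  rewrite nx -qy; apply: le_trans (ler_norm _) _; exact: qform_abs.
(* [x] attains the maximum, so its residual vanishes. *)
have : normsq (fun v => mu * x v - apply_form a x v) <= 0.
  apply: le_trans (HK x) _; nra.
by move=> H v; have := normsq_eq0 v H => /= ?; lra.
Qed.

End TopEigenvector.

Section SpectralRadius.
Variables (R : realType) (V : finType) (E : rel V).
Hypothesis symE : symmetric E.
Let a v w : R := (E v w)%:R.

(** [eigenvalue] multiplies row vectors from the left; symmetry of [E] identifies this with
    [apply_form]. *)
Lemma eigenvalue_adjP (c : R) :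
  eigenvalue (adj R E) c <->
  exists2 y : V -> R, (forall v, apply_form a y v = c * y v) & exists v, y v != 0.
Proof.
have enumV : bijective (@enum_val _ V).
  by exists enum_rank => i; rewrite ?enum_valK ?enum_rankK.
split.
  move/eigenvalueP => [r rA r0].
  exists (fun v => r 0 (enum_rank v)).
    move=> v; move/rowP: rA => /(_ (enum_rank v)); rewrite !mxE => <-.
    rewrite /apply_form (reindex (@enum_val _ V)); last exact: onW_bij.
    apply: eq_bigr => i _; rewrite !mxE enum_valK enum_rankK mulrC.
    by rewrite /a symE.
  have [i ri] : exists i, r 0 i != 0.
    apply/existsP; apply: contraR r0; rewrite negb_exists => /forallP H.
    by apply/eqP/rowP => i; rewrite mxE; apply/eqP; have := H i; rewrite negbK.
  by exists (enum_val i); rewrite enum_valK.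
move=> [y ey [v yv]]; apply/eigenvalueP.
exists (\row_i y (enum_val i)).
  apply/rowP => j; rewrite !mxE -ey /apply_form.
  rewrite (reindex (@enum_val _ V)); last exact: onW_bij.
  by apply: eq_bigr => i _; rewrite !mxE mulrC /a symE.
apply: contra yv => /eqP/rowP/(_ (enum_rank v)); rewrite !mxE enum_rankK.
by move=> ->.
Qed.

(** Passing to absolute values bounds the modulus of every eigenvalue by the top Rayleigh quotient,
    so the supremum of moduli in [lambda] is that quotient. *)
Lemma spectral_radius_perron : (0 < #|V|)%N ->
  (forall y : V -> R, qform a y <= lambda R E * normsq y) /\
  exists x : V -> R,
  [/\ forall v, 0 <= x v, exists v, 0 < x v &
      forall v, apply_form a x v = lambda R E * x v].
Proof.
move=> V0.
have asym v w : a v w = a w v by rewrite /a symE.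
have age0 v w : 0 <= a v w by rewrite /a ler0n.
have [mu [x [psd x0 [v xv] ex]]] := top_eigenvector asym age0 V0.
have mu0 : 0 <= mu.
  have : 0 <= apply_form a x v by apply: sumr_ge0 => w _; rewrite mulr_ge0.
  by rewrite ex pmulr_lge0.
have inS : [set `|c| | c in [set c : R | eigenvalue (adj R E) c]]%classic mu.
  exists mu; last by rewrite ger0_norm.
  by apply/eigenvalue_adjP; exists x => //; exists v; rewrite gt_eqF.
suff -> : lambda R E = mu by split=> //; exists x; split=> //; exists v.
have ubS : ubound [set `|c| | c in [set c : R | eigenvalue (adj R E) c]]%classic mu.
  move=> _ [c /eigenvalue_adjP[y ey [w yw]] <-].
  have y0 := normsq_gt0 yw.
  rewrite -(ler_pM2r y0) -{1}(gtr0_norm y0) -normrM.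
  have -> : c * normsq y = qform a y.
    rewrite qformE /normsq big_distrr; apply: eq_bigr => u _; rewrite ey /=; ring.
  apply: le_trans (qform_abs age0 y) _.
  by rewrite -(normsq_abs y) psd.
apply/eqP; rewrite eq_le; apply/andP; split.
  by apply: ge_sup => //; exists mu.
by apply: ub_le_sup => //; exists mu.
Qed.

End SpectralRadius.

(** * Spectral radius of subgraphs and of split graphs *)

Lemma lambda_ge0 (R : realType) (V : finType) (E : rel V) :
  symmetric E -> (0 < #|V|)%N -> 0 <= lambda R E.
Proof.
move=> symE V0; have [_ [x [x0 [v xv] ex]]] := spectral_radius_perron R symE V0.
have : 0 <= apply_form (fun v w => (E v w)%:R) x v.
  by apply: sumr_ge0 => w _; rewrite mulr_ge0.
by rewrite ex pmulr_lge0.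
Qed.

(** The Perron vector is pushed forward along the embedding. As [f] may identify isolated vertices,
    only the others are moved; isolated ones contribute nothing to the form. *)
Lemma lambda_subgraph (R : realType) (V W : finType) (E : rel V) (E' : rel W) :
  symmetric E -> symmetric E' -> (0 < #|V|)%N ->
  subgraph E E' -> lambda R E <= lambda R E'.
Proof.
move=> symE symE' V0 [f [finj fE]].
have W0 : (0 < #|W|)%N.
  by case/card_gt0P: V0 => v _; apply/card_gt0P; exists (f v).
have [_ [x [x0 [v0 xv0] ex]]] := spectral_radius_perron R symE V0.
have [psd _] := spectral_radius_perron R symE' W0.
pose P v := nonisol E v.
pose z w := \sum_(v | P v && (f v == w)) x v.
have zsum (h : W -> R) : \sum_w z w * h w = \sum_(v | P v) x v * h (f v).
  rewrite (partition_big f predT) //=; apply: eq_bigr => w _.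
  by rewrite big_distrl; apply: eq_bigr => v /andP[_ /eqP ->].
have zf v : P v -> z (f v) = x v.
  move=> Pv; rewrite /z (big_pred1 v) // => w /=.
  apply/andP/eqP => [[Pw /eqP]|->]; last by rewrite Pv.
  by move=> /finj ->.
have nz : normsq z <= normsq x.
  rewrite /normsq; under eq_bigr do rewrite expr2.
  rewrite zsum [leRHS](bigID P) /= -[leLHS]addr0; apply: lerD; last first.
    by apply: sumr_ge0 => ? _; exact: sqr_ge0.
  by apply: ler_sum => v Pv; rewrite zf.
have qz : lambda R E * normsq x <= qform (fun v w => (E' v w)%:R) z.
  rewrite qformE zsum /normsq big_distrr /= (bigID P) /= [X in _ + X]big1 ?addr0.
    apply: ler_sum => v Pv.
    rewrite expr2 mulrCA -ex; apply: ler_wpM2l => //.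
    rewrite /apply_form; under [leRHS]eq_bigr do rewrite mulrC.
    rewrite zsum (bigID P) /= [X in _ + X]big1 ?addr0.
      apply: ler_sum => w Pw; rewrite mulrC; apply: ler_wpM2l => //.
      by rewrite ler_nat; case: (boolP (E v w)) => // /fE ->.
    move=> w /negP Pw; case: (boolP (E v w)) => Evw; last by rewrite mul0r.
    by case: Pw; apply/existsP; exists v; rewrite symE.
  move=> v /negP Pv; rewrite expr2 mulrCA -ex /apply_form big1 ?mulr0 // => w _.
  case: (boolP (E v w)) => Evw; last by rewrite mul0r.
  by case: Pv; apply/existsP; exists w.
have nx : 0 < normsq x by apply: (@normsq_gt0 _ _ _ v0); rewrite gt_eqF.
have H := le_trans qz (psd z).
rewrite -(ler_pM2r nx); apply: le_trans H _.
by apply: ler_wpM2l => //; exact: lambda_ge0.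
Qed.

Lemma lambda_isomorphic (R : realType) (V W : finType) (E : rel V) (E' : rel W) :
  symmetric E -> symmetric E' -> (0 < #|V|)%N ->
  isomorphic E E' -> lambda R E = lambda R E'.
Proof.
move=> symE symE' V0 [f [finj [fni [fsurj fE]]]].
have niE v w : E v w -> nonisol E v by move=> H; apply/existsP; exists w.
have niE' v w : E' v w -> nonisol E' v by move=> H; apply/existsP; exists w.
have sub1 : subgraph E E'.
  exists f; split=> // v w vw; rewrite -fE //; first exact: niE vw.
  by apply: (@niE w v); rewrite symE.
have W0 : (0 < #|W|)%N.
  by case/card_gt0P: V0 => v _; apply/card_gt0P; exists (f v).
have [v0 _] := card_gt0P V0.
pose g w := odflt v0 [pick v | nonisol E v && (f v == w)].
have gP w : nonisol E' w -> nonisol E (g w) /\ f (g w) = w.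
  move=> /fsurj [v [nv fv]]; rewrite /g; case: pickP => [v' /andP[? /eqP]//|].
  by move=> /(_ v); rewrite nv fv eqxx.
have sub2 : subgraph E' E.
  exists g; split.
    by move=> v w /gP[_ gv] /gP[_ gw] e; rewrite -gv e gw.
  move=> v w vw; have [n1 e1] := gP v (niE' _ _ vw).
  have [n2 e2] : nonisol E (g w) /\ f (g w) = w.
    by apply/gP/(@niE' w v); rewrite symE'.
  by rewrite fE // e1 e2.
by apply/eqP; rewrite eq_le !lambda_subgraph.
Qed.

Lemma split_graph_sym k m : symmetric (split_graph k m).
Proof. by move=> x y; rewrite /split_graph eq_sym orbC. Qed.

Lemma sum_const_ord (R : pzRingType) (n : nat) (c : R) : \sum_(i < n) c = n%:R * c.
Proof. by rewrite sumr_const card_ord mulr_natl. Qed.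

(** The outer entries [Z / l] and [Zs / l] maximise [2 y Z - l y^2] and its analogue for [Zs]. Only
    [lambda <= l] is assumed, so that [l] can later be the spectral radius of the other graph. *)
Lemma split_rayleigh (R : realType) (k m : nat) (z : nat -> R) (l : R) :
  (0 < k)%N -> lambda R (split_graph k m) <= l -> 0 < l ->
  \sum_(i < k) \sum_(j < k | j != i) z i * z j
    + l^-1 * ((split_t k m)%:R * (\sum_(i < k) z i) ^+ 2
              + (\sum_(i < k) ((i < split_s k m)%N)%:R * z i) ^+ 2)
  <= l * \sum_(i < k) z i ^+ 2.
Proof.
move=> k0 lam l0; set Z := \sum_(i < k) z i; set Zs := \sum_(i < k) _%:R * _; set s := split_s k m; set t := split_t k m.
have sk : (s < k)%N by rewrite /s /split_s ltn_mod.
have n0 : (0 < #|'I_(split_n k m)|)%N by rewrite card_ord /split_n addn1.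
have [psd _] := spectral_radius_perron R (@split_graph_sym k m) n0.
(* Adjacency on plain naturals, so that sums can be cut at [k] and [k + t]. *)
pose ad i j := (i != j :> nat) && (split_adj0 k t s i j || split_adj0 k t s j i).
pose y i := if (i < k)%N then z i else if (i < k + t)%N then Z / l else Zs / l.
pose ay i := \sum_(0 <= j < k + t + 1) (ad i j)%:R * y j.
have sumsplit (h : nat -> R) : \sum_(0 <= i < k + t + 1) h i =
   \sum_(i < k) h i + \sum_(i < t) h (k + i)%N + h (k + t)%N.
  rewrite addn1 big_nat_recr //= (big_cat_nat (n := k)) ?leq_addr //=.
  rewrite big_mkord; congr (_ + _ + _).
  rewrite -{1}[k]add0n big_addn addKn big_mkord.
  by apply: eq_bigr => i _; rewrite addnC.
have y1 i : (i < k)%N -> y i = z i by rewrite /y => ->.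
have y2 i : (i < t)%N -> y (k + i)%N = Z / l.
  by move=> it; rewrite /y ltnNge leq_addr /= ltn_add2l it.
have y3 : y (k + t)%N = Zs / l by rewrite /y ltnNge leq_addr /= ltnn.
have ay1 i : (i < k)%N -> ay i = (Z - z i) + t%:R * (Z / l) + (i < s)%:R * (Zs / l).
  move=> ik; rewrite /ay sumsplit; congr (_ + _ + _).
  - rewrite /Z [in RHS](bigD1 (Ordinal ik)) //= [in LHS](bigD1 (Ordinal ik)) //=.
    rewrite /ad eqxx mul0r add0r addrAC subrr add0r; apply: eq_bigr => j.
    rewrite -val_eqE eq_sym /= => ji.
    by rewrite y1 // ji /split_adj0 ik ltn_ord mul1r.
  - rewrite (eq_bigr (fun=> Z / l)); first by rewrite sumr_const card_ord mulr_natl.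
    move=> j _; rewrite y2 // (_ : ad i (k + j)%N = true) ?mul1r //.
    by rewrite /ad /split_adj0; have := ltn_ord j; lia.
  - rewrite y3 (_ : ad i (k + t)%N = (i < s)%N) //.
    by rewrite /ad /split_adj0; lia.
have ay2 i : (i < t)%N -> ay (k + i)%N = Z.
  move=> it.
  rewrite /ay sumsplit [X in _ + X + _]big1 ?addr0.
    rewrite [X in _ + X](_ : _ = 0) ?addr0.
      apply: eq_bigr => j _; rewrite y1 // (_ : ad _ _ = true) ?mul1r //.
      by rewrite /ad /split_adj0; have := ltn_ord j; lia.
    rewrite (_ : ad _ _ = false) ?mul0r //.
    by rewrite /ad /split_adj0; lia.
  move=> j _; rewrite (_ : ad _ _ = false) ?mul0r //.
  by rewrite /ad /split_adj0; have := ltn_ord j; lia.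
have ay3 : ay (k + t)%N = Zs.
  rewrite /ay sumsplit [X in _ + X + _]big1 ?addr0.
    rewrite /ad eqxx mul0r addr0 -/(ad _); apply: eq_bigr => j _; rewrite y1 //.
    congr (_%:R * _); rewrite /split_adj0 -/s; have := ltn_ord j; lia.
  move=> j _; rewrite (_ : ad _ _ = false) ?mul0r //.
  by rewrite /ad /split_adj0; have := ltn_ord j; lia.
have H := psd (fun i => y i).
have E1 : qform (fun v w => (split_graph k m v w)%:R) (fun i => y i) =
   \sum_(0 <= i < k + t + 1) y i * ay i.
  rewrite qformE big_mkord; apply: eq_bigr => i _; congr (_ * _).
  by rewrite /apply_form /ay big_mkord; apply: eq_bigr => j _.
have E2 : normsq (fun i : 'I_(split_n k m) => y i) = \sum_(0 <= i < k + t + 1) y i ^+ 2.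
  by rewrite /normsq big_mkord.
have H2 : qform (fun v w => (split_graph k m v w)%:R) (fun i => y i) <=
  l * normsq (fun i : 'I_(split_n k m) => y i).
  by apply: le_trans H _; apply: ler_wpM2r => //; exact: normsq_ge0.
have ZsE : Zs ^+ 2 = \sum_(i < k) z i * ((i < s)%N%:R * Zs).
  rewrite expr2 {1}/Zs big_distrl; apply: eq_bigr => i _ /=; rewrite -/s; ring.
have ZZ : \sum_(i < k) z i * (Z - z i) = \sum_(i < k) \sum_(j < k | j != i) z i * z j.
  apply: eq_bigr => i _; rewrite -big_distrr /=; congr (_ * _).
  by rewrite /Z (bigD1 i) //= addrAC subrr add0r.
move: H2; rewrite E1 E2 !sumsplit y3.
rewrite ay3 //.
rewrite (eq_bigr (fun i : 'I_k => z i * (Z - z i) + t%:R * (Z / l) * z i +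
    l^-1 * (z i * ((i < s)%N%:R * Zs)))); last first.
  by move=> i _; rewrite y1 // ay1 //; ring.
rewrite !big_split /= -!big_distrr -ZsE -/Z ZZ /=.
rewrite (eq_bigr (fun i : 'I_t => Z / l * Z)); last by move=> i _; rewrite y2 // ay2.
rewrite [X in _ <= _ * (X + _ + _)](eq_bigr (fun i : 'I_k => z i ^+ 2)); last first.
  by move=> i _; rewrite y1.
rewrite [X in _ <= _ * (_ + X + _)](eq_bigr (fun i : 'I_t => (Z / l) ^+ 2)); last first.
  by move=> i _; rewrite y2.
rewrite !sum_const_ord.
set P := \sum_(i < k) _; set Q := \sum_(i < k) _.
have -> : l * (Q + t%:R * (Z / l) ^+ 2 + (Zs / l) ^+ 2) =
   l * Q + l^-1 * (t%:R * Z ^+ 2 + Zs ^+ 2).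
  by field; rewrite gt_eqF.
have -> : P + t%:R * (Z / l) * Z + l^-1 * Zs ^+ 2 + t%:R * (Z / l * Z) + Zs / l * Zs =
  P + 2 * (l^-1 * (t%:R * Z ^+ 2 + Zs ^+ 2)) by ring.
lra.
Qed.

(** The test vector is constant on the clique, and the contribution of the extra vertex is
    dropped. *)
Lemma split_lambda_lower (R : realType) (k m : nat) (l : R) : (0 < k)%N ->
  lambda R (split_graph k m) <= l -> 0 < l ->
  (k * split_t k m)%:R <= l ^+ 2 - k.-1%:R * l.
Proof.
move=> k0 lam l0; have /= := split_rayleigh (fun=> 1) k0 lam l0.
set Zs := \sum_(i < k) _ * 1.
rewrite (eq_bigr (fun=> k.-1%:R)) => [|i _]; last first.
  by rewrite mulr1 sumr_const cardC1 card_ord.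
rewrite expr1n !sum_const_ord !mulr1 => H.
have kR : 0 < (k%:R : R) by rewrite ltr0n.
have H2 : k%:R * k.-1%:R + l^-1 * ((split_t k m)%:R * k%:R ^+ 2) <= l * (k%:R : R).
  apply: le_trans H; rewrite lerD2l; apply: ler_wpM2l; first by rewrite invr_ge0 ltW.
  by rewrite lerDl sqr_ge0.
have H3 := ler_wpM2l (ltW l0) H2.
rewrite mulrDr [X in _ + X]mulrA divff ?gt_eqF // mul1r in H3.
rewrite natrM -(ler_pM2l kR); lra.
Qed.

(** * Boundedness of the Perron vector *)

Lemma handshake (V : finType) (E : rel V) : simple_graph E ->
  (\sum_v \sum_w E v w = 2 * nedges E)%N.
Proof.
case=> symE irrE; rewrite /nedges -sum1_card big_distrr /=.
rewrite pair_big /= (bigID (fun p => E p.1 p.2)) /= [X in (_ + X)%N]big1; last first.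
  by move=> p /negPf ->.
rewrite addn0 (partition_big (fun p => [set p.1; p.2])
  (mem [set e : {set V} | [exists x, exists y, E x y && (e == [set x; y])]])) /=.
  apply: eq_bigr => e; rewrite inE => /existsP[x /existsP[y /andP[xy /eqP ->]]].
  have nxy : x != y by apply: contraTneq xy => ->; rewrite irrE.
  rewrite (eq_bigr (fun=> 1%N)) => [|p /andP[-> //]].
  rewrite sum1dep_card.
  rewrite (_ : [set p | _] = [set (x, y); (y, x)]).
    by rewrite cards2 xpair_eqE negb_and nxy.
  apply/setP => -[v w]; rewrite !inE /= !xpair_eqE.
  apply/idP/idP => [/andP[vw /eqP/setP H]|].
    have := H v; have := H w; rewrite !inE !eqxx orbT /= => /esym ew /esym ev.
    case/orP: ew vw => /eqP ->; case/orP: ev => /eqP ->; rewrite ?irrE //.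
      by rewrite !eqxx orbT.
    by rewrite !eqxx.
  case/orP => /andP[/eqP -> /eqP ->]; first by rewrite xy eqxx.
  by rewrite symE xy setUC eqxx.
move=> [v w] /= vw; rewrite inE; apply/existsP; exists v; apply/existsP; exists w.
by rewrite vw eqxx.
Qed.

Definition common_nbrs (V : finType) (E : rel V) (U : {set V}) : {set V} :=
  [set w | [forall v in U, E v w]].

Lemma common_nbrsU1 (V : finType) (E : rel V) u (U : {set V}) w :
  (w \in common_nbrs E (u |: U)) = E u w && (w \in common_nbrs E U).
Proof.
rewrite !inE; apply/forall_inP/andP => [H|[uw /forall_inP H] v].
  split; first by apply: H; rewrite setU11.
  by apply/forall_inP => v vU; apply: H; rewrite setU1r.
by rewrite !inE => /orP[/eqP ->|/H].
Qed.

Lemma common_nbrsP (V : finType) (E : rel V) (U : {set V}) w :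
  reflect (forall v, v \in U -> E v w) (w \in common_nbrs E U).
Proof. by rewrite inE; apply: forall_inP. Qed.

Definition biclique_free (V : finType) (E : rel V) (a b : nat) : Prop :=
  forall U : {set V}, #|U| = a -> (#|common_nbrs E U| < b)%N.

Section DenseWeights.
Variables (R : realType) (V : finType) (E : rel V) (p : V -> R).
Hypothesis p0 : forall v, 0 <= p v.
Hypothesis p1 : \sum_v p v = 1.

(** Averaging: the chosen set [U] takes at most [a q <= c / 2] from each weighted degree, so fresh
    vertices see on average a fraction [c / 2] of the current set. Asking for [c / 4] only leaves
    room for a strict inequality. *)
Lemma greedy_common_nbrs (Y : {set V}) (c q : R) (a : nat) :
  0 < c -> 0 < \sum_(v in Y) p v ->
  (forall v, v \in Y -> c <= \sum_(u | E u v) p u) ->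
  (forall v, p v <= q) -> a%:R * q <= c / 2 ->
  forall i, (i <= a)%N -> exists2 U : {set V}, #|U| = i &
    (c / 4) ^+ i * \sum_(v in Y) p v <= \sum_(v in Y :&: common_nbrs E U) p v.
Proof.
move=> c0 Y0 cY pq aq; elim=> [_|i IH ia].
  exists set0; first by rewrite cards0.
  rewrite expr0 mul1r (_ : _ :&: _ = Y) //.
  by apply/setIidPl/subsetP => w _; apply/common_nbrsP => v; rewrite inE.
have [U Ui HU] := IH (ltnW ia).
set YU := Y :&: common_nbrs E U in HU; set pY := \sum_(v in YU) p v in HU.
have pY0 : 0 < pY by apply: lt_le_trans HU; rewrite mulr_gt0 // exprn_gt0 // divr_gt0.
pose h u := \sum_(v in YU | E u v) p v.
have h1 : c / 2 * pY <= \sum_(u | u \notin U) p u * h u.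
  rewrite /h; under eq_bigr do rewrite big_distrr /= big_mkcondr /=.
  rewrite exchange_big /= /pY big_distrr /=; apply: ler_sum => v vY.
  have vY' : v \in Y by move: vY; rewrite inE => /andP[].
  have -> : \sum_(u | u \notin U) (if E u v then p u * p v else 0)
     = (\sum_(u | (u \notin U) && E u v) p u) * p v.
    by rewrite big_distrl /= [RHS]big_mkcondr.
  apply: ler_wpM2r => //.
  rewrite (eq_bigl _ _ (fun u => andbC _ _)).
  have := cY v vY'; rewrite (bigID (fun u => u \in U)) /=.
  have : \sum_(u | E u v && (u \in U)) p u <= i%:R * q.
    rewrite -Ui mulr_natl -sumr_const big_mkcondl /=; apply: ler_sum => u _.
    by case: ifP => // _; apply: le_trans (p0 u) (pq u).
  have : i%:R * q <= a%:R * q.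
    apply: ler_wpM2r; last by rewrite ler_nat ltnW.
    exact: le_trans (p0 v) (pq v).
  lra.
have [u uU hu] : exists2 u, u \notin U & c / 4 * pY <= h u.
  apply: contrapT => /forall2NP H.
  have : \sum_(u | u \notin U) p u * h u <= \sum_(u | u \notin U) p u * (c / 4 * pY).
    apply: ler_sum => u uU; apply: ler_wpM2l => //.
    by case: (H u) => // /negP; rewrite -ltNge => /ltW.
  have : \sum_(u | u \notin U) p u <= 1.
    rewrite -p1 [leRHS](bigID (fun u => u \notin U)) /= lerDl.
    by apply: sumr_ge0.
  rewrite -big_distrl /=.
  have cp : 0 < c * pY by rewrite mulr_gt0.
  have s0 : 0 <= \sum_(u | u \notin U) p u by apply: sumr_ge0.
  nra.
exists (u |: U); first by rewrite cardsU1 uU Ui.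
have -> : \sum_(v in Y :&: common_nbrs E (u |: U)) p v = h u.
  by apply: eq_bigl => v; rewrite in_setI common_nbrsU1 in_setI andbCA andbC.
apply: le_trans hu; rewrite exprS -mulrA; apply: ler_wpM2l => //.
by rewrite ltW // divr_gt0.
Qed.

(** Vertices of weighted degree at least [1/8] carry weight at least [1/8], since the others add at
    most [1/8] to the density. The greedy choice with [c = 1/8] gives [32^-a / 8 <= b q]; the term
    [16 a] comes from its requirement [a q <= c / 2]. *)
Lemma dense_weights_concentrate (a b : nat) (q : R) :
  biclique_free E a b -> (forall v, p v <= q) -> symmetric E ->
  1 / 4 <= \sum_v \sum_w (E v w)%:R * (p v * p w) ->
  1 <= (16 * a%:R + 8 * b%:R * 32 ^+ a) * q.
Proof.
move=> free pq symE dense.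
pose deg v := \sum_(u | E u v) p u.
pose Y := [set v | 1 / 8 <= deg v].
have degE v : deg v = \sum_w (E v w)%:R * p w.
  rewrite /deg big_mkcond; apply: eq_bigr => w _; rewrite symE.
  by case: (E v w); rewrite ?mul1r ?mul0r.
have deg1 v : deg v <= 1.
  rewrite -p1 /deg [leRHS](bigID (fun u => E u v)) /= lerDl.
  by apply: sumr_ge0.
have pY : 1 / 8 <= \sum_(v in Y) p v.
  have EY : \sum_v \sum_w (E v w)%:R * (p v * p w) = \sum_v p v * deg v.
    apply: eq_bigr => v _; rewrite degE big_distrr; apply: eq_bigr => w _ /=; ring.
  rewrite EY (bigID (fun v => v \in Y)) /= in dense.
  have : \sum_(v in Y) p v * deg v <= \sum_(v in Y) p v.
    by apply: ler_sum => v _; rewrite ler_piMr.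
  have : \sum_(v | v \notin Y) p v * deg v <= \sum_(v | v \notin Y) p v * (1 / 8).
    by apply: ler_sum => v; rewrite inE -ltNge => /ltW H; exact: ler_wpM2l.
  have : \sum_(v | v \notin Y) p v <= 1.
    rewrite -p1 [leRHS](bigID (fun u => u \notin Y)) /= lerDl.
    by apply: sumr_ge0.
  rewrite -big_distrl /=; move: dense; lra.
rewrite leNgt; apply/negP => small.
have [v0 v0Y] : exists v, v \in Y.
  apply/set0Pn; apply: contraTneq pY => ->.
  by rewrite big_set0 -ltNge divr_gt0.
have q0 : 0 <= q := le_trans (p0 v0) (pq v0).
have a0 : 0 <= (a%:R : R) := ler0n _ _.
have b0 : 0 <= (b%:R : R) := ler0n _ _.
have e0 : 0 < (32 : R) ^+ a by rewrite exprn_gt0.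
have abq : 0 <= a%:R * q by rewrite mulr_ge0.
have bbq : 0 <= b%:R * 32 ^+ a * q by rewrite !mulr_ge0 // ltW.
have aq : a%:R * q <= 1 / 8 / 2 by lra.
have [|||U Ua HU] := @greedy_common_nbrs Y (1 / 8) q a _ _ _ pq aq a (leqnn a).
- by rewrite divr_gt0.
- by apply: lt_le_trans pY; lra.
- by move=> v; rewrite inE.
have Hb : \sum_(v in Y :&: common_nbrs E U) p v <= b%:R * q.
  apply: (@le_trans _ _ (\sum_(v in common_nbrs E U) q)).
    apply: (@le_trans _ _ (\sum_(v in Y :&: common_nbrs E U) q)).
      by apply: ler_sum.
    rewrite [leRHS](big_setID Y) /= setIC lerDl.
    by apply: sumr_ge0.
  rewrite sumr_const -[leLHS]mulr_natl; apply: ler_wpM2r => //.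
  by rewrite ler_nat ltnW // free.
have H32 : (1 / 8 / 4 : R) ^+ a * 32 ^+ a = 1.
  by rewrite -exprMn (_ : _ * _ = 1) ?expr1n //; field.
have e1 : 0 < (1 / 8 / 4 : R) ^+ a by rewrite exprn_gt0 // !divr_gt0.
have H1 : (1 / 8 / 4 : R) ^+ a * (1 / 8) <= b%:R * q.
  by apply: le_trans Hb; apply: le_trans HU; rewrite ler_pM2l.
have := ler_wpM2r (ltW e0) H1; rewrite mulrAC H32; lra.
Qed.

End DenseWeights.

(** With [N = normsq x], Cauchy-Schwarz reads [(l N)^2 <= 2 m D], so [m <= 2 l^2] gives density
    [D / N^2 >= 1/4] for the weights [x^2 / N]. None of these exceeds [1 / N], so concentration
    bounds [N]. *)
Lemma eigenvector_normsq_bound (R : realType) (V : finType) (E : rel V)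
    (x : V -> R) (l : R) (u : V) (a b : nat) :
  simple_graph E -> biclique_free E a b ->
  (forall v, apply_form (fun v w => (E v w)%:R) x v = l * x v) ->
  (forall v, 0 <= x v <= 1) -> x u = 1 -> 0 < l ->
  (nedges E)%:R <= 2 * l ^+ 2 ->
  normsq x <= 16 * a%:R + 8 * b%:R * 32 ^+ a.
Proof.
move=> gE free ex x01 xu l0 ml.
have [symE irrE] := gE.
set N := normsq x.
have N0 : 0 < N by apply: (@normsq_gt0 _ _ _ u); rewrite xu oner_eq0.
have CS := sum_cauchy_schwarz (fun e : V * V => (E e.1 e.2)%:R : R)
  (fun e => (E e.1 e.2)%:R * (x e.1 * x e.2)).
have e1 : \sum_(e : V * V) ((E e.1 e.2)%:R : R) ^+ 2 = 2 * (nedges E)%:R.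
  rewrite -natrM -handshake // pair_big natr_sum; apply: eq_bigr => e _.
  by case: (E _ _); rewrite ?expr1n ?expr0n.
have e2 : \sum_(e : V * V) ((E e.1 e.2)%:R : R) * ((E e.1 e.2)%:R * (x e.1 * x e.2))
   = l * N.
  transitivity (qform (fun v w => (E v w)%:R) x).
    rewrite /qform pair_big; apply: eq_bigr => e _.
    by case: (E _ _); rewrite /= ?mul1r ?mul0r.
  rewrite qformE /N /normsq big_distrr; apply: eq_bigr => v _; rewrite ex /=; ring.
pose D := \sum_v \sum_w (E v w)%:R * (x v ^+ 2 * x w ^+ 2).
have e3 : \sum_(e : V * V) ((E e.1 e.2)%:R * (x e.1 * x e.2)) ^+ 2 = D.
  rewrite /D pair_big; apply: eq_bigr => e _.
  by case: (E _ _); rewrite /= ?mul1r ?mul0r ?expr0n // exprMn.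
rewrite e1 e2 e3 in CS.
have D0 : 0 <= D.
  by do 2 (apply: sumr_ge0 => ? _); apply: mulr_ge0 => //; apply: mulr_ge0; exact: sqr_ge0.
have DN : N ^+ 2 <= 4 * D.
  have l2 : 0 < l ^+ 2 by rewrite exprn_gt0.
  rewrite -(ler_pM2l l2) -exprMn; apply: le_trans CS _.
  have := ler_wpM2r D0 ml; lra.
pose p v := x v ^+ 2 / N.
have Ni : N^-1 * N = 1 by rewrite mulVf // gt_eqF.
have p0 v : 0 <= p v by rewrite /p divr_ge0 ?sqr_ge0 // ltW.
have p1 : \sum_v p v = 1 by rewrite /p -big_distrl /= divff // gt_eqF.
have pq v : p v <= N^-1.
  rewrite /p ler_piMl //; first by rewrite invr_ge0 ltW.
  have /andP[xv0 xv1] := x01 v; rewrite expr_le1 //.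
have dense : 1 / 4 <= \sum_v \sum_w (E v w)%:R * (p v * p w).
  have -> : \sum_v \sum_w (E v w)%:R * (p v * p w) = D / N ^+ 2.
    rewrite /D big_distrl; apply: eq_bigr => v _ /=.
    rewrite big_distrl; apply: eq_bigr => w _ /=.
    by rewrite /p; field; rewrite gt_eqF.
  by rewrite ler_pdivlMr ?exprn_gt0 //; lra.
have := dense_weights_concentrate p0 p1 free pq symE dense.
by rewrite ler_pdivlMr // mul1r.
Qed.

(** * Stability *)

Lemma subset_of_card (V : finType) (A : {set V}) (n : nat) :
  (n <= #|A|)%N -> exists2 B : {set V}, B \subset A & #|B| = n.
Proof.
move=> nA; have : (0 < #|[set B : {set V} | B \subset A & #|B| == n]|)%N.
  by rewrite cards_draws bin_gt0.
by case/card_gt0P => B; rewrite inE => /andP[BA /eqP Bn]; exists B.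
Qed.

Lemma card_bigcup_le (I V : finType) (P : pred I) (F : I -> {set V}) :
  (#|\bigcup_(i | P i) F i| <= \sum_(i | P i) #|F i|)%N.
Proof.
elim/big_rec2: _ => [|i n A _ IH]; first by rewrite cards0.
by apply: leq_trans (leq_card_setU _ _) _; rewrite leq_add2l.
Qed.

(** Union bound over the [a]-subsets of [L], each with fewer than [b] common neighbours. *)
Lemma many_nbrs_card (V : finType) (E : rel V) (L : {set V}) (a b : nat) :
  symmetric E -> biclique_free E a b ->
  (#|[set w | (a <= #|[set v in L | E w v]|)%N]| <= b * 2 ^ #|L|)%N.
Proof.
move=> symE free.
apply: (@leq_trans #|\bigcup_(T : {set V} | (T \subset L) && (#|T| == a)) common_nbrs E T|).
  apply/subset_leq_card/subsetP => w; rewrite inE => /subset_of_card[T TL Ta].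
  apply/bigcupP; exists T.
    rewrite Ta eqxx andbT; apply: subset_trans TL _.
    by apply/subsetP => v; rewrite inE => /andP[].
  by apply/common_nbrsP => v /(subsetP TL); rewrite inE symE => /andP[].
apply: leq_trans (card_bigcup_le _ _) _.
apply: (@leq_trans (\sum_(T in powerset L) b)%N).
  rewrite big_mkcond [X in (_ <= X)%N]big_mkcond; apply: leq_sum => T _.
  rewrite inE; case: (T \subset L) => //=; case: eqP => //= Ta.
  exact/ltnW/free.
by rewrite sum_nat_const card_powerset mulnC.
Qed.

Lemma sum_indicator (R : pzRingType) (V : finType) (P : {set V}) :
  \sum_v (v \in P)%:R = #|P|%:R :> R.
Proof.
rewrite -sum1_card natr_sum [RHS]big_mkcond; apply: eq_bigr => v _.
by case: (v \in P).
Qed.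

Section Stability.
Variables (R : realType) (V : finType) (E : rel V).
Variables (k b ell : nat) (C0 : R) (x : V -> R) (l : R) (u : V).
Hypothesis k0 : (0 < k)%N.
Hypothesis symE : symmetric E.
Hypothesis irrE : irreflexive E.
Hypothesis free : biclique_free E k.+1 b.
Let A v w : R := (E v w)%:R.
Hypothesis ex : forall v, apply_form A x v = l * x v.
Hypothesis x0 : forall v, 0 <= x v.
Hypothesis x1 : forall v, x v <= 1.
Hypothesis xu : x u = 1.
Hypothesis l1 : 1 <= l.
Hypothesis lC0 : (\sum_v \sum_w A v w) / 2 - C0 <= l ^+ 2 - k.-1%:R * l.
Hypothesis C00 : 0 <= C0.
Let L := [set v | 1 / 3 <= x v].
Hypothesis Lell : (#|L| <= ell)%N.

(* Indicators of the neighbours of [u] ([n]) and their complement ([o]), of [L]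
   ([g]), and of the neighbours of [u] outside ([nS]) and inside ([nL]) [L]. *)
Let n v : R := (E u v)%:R.
Let o v : R := (~~ E u v)%:R.
Let g v : R := (v \in L)%:R.
Let nS v : R := (E u v && (v \notin L))%:R.
Let nL v : R := (E u v && (v \in L))%:R.
Let D w := #|[set v in L | E u v && E w v]|.

Let A0 v w : 0 <= A v w. Proof. exact: ler0n. Qed.
Let Asym v w : A v w = A w v. Proof. by rewrite /A symE. Qed.

Let sumA0 (F : V -> V -> R) : (forall v w, 0 <= F v w) ->
  0 <= \sum_v \sum_w A v w * F v w.
Proof. by move=> F0; do 2 (apply: sumr_ge0 => ? _); rewrite mulr_ge0. Qed.

Lemma edge_sum_sym (F : V -> V -> R) :
  2 * \sum_v \sum_w A v w * F v w = \sum_v \sum_w A v w * (F v w + F w v).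
Proof.
rewrite mulr_natl mulr2n {2}exchange_big -big_split; apply: eq_bigr => v _ /=.
by rewrite -big_split; apply: eq_bigr => w _ /=; rewrite [A w v]Asym; ring.
Qed.

Lemma card_heavy_bound : \sum_v g v <= ell%:R.
Proof. by rewrite sum_indicator ler_nat. Qed.

Lemma entry_outside v : v \notin L -> x v <= 1 / 3.
Proof. by rewrite inE -ltNge => /ltW. Qed.

(** For an ordered edge, [n v * x w] is its share of [l^2] and [1/2] its share of the edge number;
    the rest is the slack to be bounded. The [- x w] beside [1 - x v] is the part later charged to
    [(k - 1) l]. *)
Definition edge_excess v w : R := n v * o w * (1 - x w) + o v * o w / 2 + nS v * nS w / 6
  + nL v * nS w * (1 - x v - x w) + n v * x w - 1 / 2.

(** Case check on the positions of [v] and [w]. Two neighbours of [u] outside [L] with entries [1/3]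
    give [2/6 + 2/3 - 1 = 0], which ties the coefficient [1/6] to the threshold [1/3]. *)
Lemma edge_excess_sym v w : edge_excess v w + edge_excess w v <= g v * g w.
Proof.
rewrite /edge_excess /n /o /nS /nL /g.
have := x0 v; have := x0 w; have := x1 v; have := x1 w.
have := @entry_outside v; have := @entry_outside w.
case: (E u v); case: (E u w); case: (v \in L); case: (w \in L) => /= Hw Hv;
  rewrite ?(mulr0, mul0r, mul1r, mulr1, add0r, addr0);
  try (move: (Hw isT)); try (move: (Hv isT)); lra.
Qed.

Lemma lambda_at_u : l = \sum_v n v * x v.
Proof. by have := ex u; rewrite xu mulr1 => <-. Qed.

Lemma sqr_lambda : l ^+ 2 = \sum_v \sum_w A v w * (n v * x w).
Proof.
rewrite expr2 {2}lambda_at_u big_distrr; apply: eq_bigr => v _ /=.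
rewrite mulrCA -ex /apply_form big_distrr; apply: eq_bigr => w _ /=; ring.
Qed.

(* [l^2] and twice the number of edges are both sums over ordered edges, so
   after symmetrisation the bound is the pointwise inequality [edge_excess_sym]. *)
Lemma edge_excess_bound : \sum_v \sum_w A v w * (n v * o w * (1 - x w))
  + (\sum_v \sum_w A v w * (o v * o w)) / 2
  + (\sum_v \sum_w A v w * (nS v * nS w)) / 6
  + (\sum_v \sum_w A v w * (nL v * nS w * (1 - x v)))
  + (\sum_w nS w * (k.-1%:R - (D w)%:R) * x w) <= C0 + ell%:R ^+ 2.
Proof.
have DE w : (D w)%:R = \sum_v A v w * nL v.
  rewrite /D -sum1dep_card natr_sum big_mkcond; apply: eq_bigr => v _.
  rewrite /A /nL [E w v]symE; case: (v \in L); case: (E u v); case: (E v w) => /=;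
  by rewrite ?mulr0 ?mul0r ?mulr1.
have -> : \sum_w nS w * (k.-1%:R - (D w)%:R) * x w =
   k.-1%:R * (\sum_w nS w * x w) - \sum_v \sum_w A v w * (nL v * nS w * x w).
  rewrite exchange_big big_distrr -sumrN -big_split; apply: eq_bigr => w _ /=.
  have -> : \sum_v A v w * (nL v * nS w * x w) = (\sum_v A v w * nL v) * (nS w * x w).
    rewrite big_distrl; apply: eq_bigr => v _ /=; ring.
  by rewrite -DE; ring.
have hsum : \sum_v \sum_w A v w * edge_excess v w = \sum_v \sum_w A v w * (n v * o w * (1 - x w))
  + (\sum_v \sum_w A v w * (o v * o w)) / 2
  + (\sum_v \sum_w A v w * (nS v * nS w)) / 6
  + (\sum_v \sum_w A v w * (nL v * nS w * (1 - x v)))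
  - \sum_v \sum_w A v w * (nL v * nS w * x w)
  + \sum_v \sum_w A v w * (n v * x w) - (\sum_v \sum_w A v w) / 2.
  rewrite !big_distrl -!sumrN -!big_split; apply: eq_bigr => v _ /=.
  rewrite !big_distrl -!sumrN -!big_split; apply: eq_bigr => w _ /=.
  by rewrite /edge_excess; field.
have hle : \sum_v \sum_w A v w * edge_excess v w <= ell%:R ^+ 2.
  have : 2 * \sum_v \sum_w A v w * edge_excess v w <= \sum_v \sum_w g v * g w.
    rewrite edge_sum_sym; apply: ler_sum => v _; apply: ler_sum => w _.
    apply: (@le_trans _ _ (A v w * (g v * g w))).
      by apply: ler_wpM2l => //; exact: edge_excess_sym.
    by rewrite ler_piMl ?mulr_ge0 ?ler0n // /A lern1 leq_b1.
  rewrite -big_distrlr /=.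
  have : (\sum_v g v) * (\sum_v g v) <= ell%:R ^+ 2.
    have s0 : 0 <= \sum_v g v by apply: sumr_ge0 => v _; exact: ler0n.
    by rewrite expr2 ler_pM // card_heavy_bound.
  have : 0 <= (ell%:R : R) ^+ 2 by exact: sqr_ge0.
  lra.
have nle : k.-1%:R * (\sum_w nS w * x w) <= k.-1%:R * l.
  apply: ler_wpM2l; first exact: ler0n.
  rewrite lambda_at_u; apply: ler_sum => v _; apply: ler_wpM2r => //.
  by rewrite /nS /n ler_nat; case: (E u v); case: (v \in L).
move: lC0 hsum hle nle; rewrite sqr_lambda; lra.
Qed.

Let C2 : R := C0 + ell%:R ^+ 2 + ell%:R * (b * 2 ^ ell)%:R.

Let C20 : 0 <= C2.
Proof. by rewrite /C2 !addr_ge0 // ?mulr_ge0 ?ler0n // exprn_ge0 ?ler0n. Qed.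

Lemma heavy_u : u \in L.
Proof. by rewrite inE xu; lra. Qed.

(** A negative term on the right needs [D w >= k]. Counting [u], such a [w] has [k + 1] neighbours
    in [L], so [many_nbrs_card] bounds their number, and each loses at most [ell]. *)
Lemma exceptional_weight :
  \sum_w (nS w * ((D w < k.-1)%N)%:R) * x w - ell%:R * (b * 2 ^ ell)%:R
  <= \sum_w nS w * (k.-1%:R - (D w)%:R) * x w.
Proof.
pose X := [set w | (k.+1 <= #|[set v in L | E w v]|)%N].
have XB : (#|X|%:R : R) <= (b * 2 ^ ell)%:R.
  rewrite ler_nat (leq_trans (many_nbrs_card L symE free)) //.
  by rewrite leq_mul2l leq_exp2l ?Lell ?orbT.
have DL w : (D w <= ell)%N.
  apply: leq_trans Lell; apply/subset_leq_card/subsetP => v.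
  by rewrite inE => /andP[].
have inX w : E u w -> (k.-1 < D w)%N -> w \in X.
  rewrite (prednK k0) inE => uw kD.
  have uD : u \notin [set v in L | E u v && E w v] by rewrite inE irrE andbF.
  rewrite (@leq_trans #|u |: [set v in L | E u v && E w v]|) //.
    by rewrite cardsU1 uD.
  apply/subset_leq_card/subsetP => v; rewrite !inE.
  by case/orP => [/eqP ->|/and3P[-> _ ->//]]; rewrite symE uw andbT xu; lra.
have : \sum_w (w \in X)%:R * (ell%:R : R) <= ell%:R * (b * 2 ^ ell)%:R.
  rewrite -big_distrl /= mulrC; apply: ler_wpM2l; first exact: ler0n.
  by rewrite sum_indicator.
have : \sum_w (nS w * ((D w < k.-1)%N)%:R) * x w <=
  \sum_w nS w * (k.-1%:R - (D w)%:R) * x w + \sum_w (w \in X)%:R * (ell%:R : R).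
  rewrite -big_split; apply: ler_sum => w _ /=; rewrite /nS.
  have Xw0 : 0 <= (w \in X)%:R * (ell%:R : R) by rewrite mulr_ge0.
  case: (boolP (E u w)) => uw /=; last by rewrite !mul0r add0r.
  case: (w \notin L); last by rewrite !mul0r add0r.
  rewrite !mul1r.
  have [kD|kD|->] := ltngtP (D w) k.-1.
  - rewrite mul1r; have : (D w)%:R + 1 <= (k.-1%:R : R) by rewrite natr1 ler_nat.
    have := x0 w; nra.
  - rewrite mul0r inX // mul1r.
    have : (D w)%:R <= (ell%:R : R) by rewrite ler_nat.
    have := ler0n R k.-1; have := ler0n R (D w); have := x0 w; have := x1 w.
    nra.
  - by rewrite subrr !mul0r add0r.
lra.
Qed.

Let bound_terms : [/\ \sum_v \sum_w A v w * (n v * o w * (1 - x w)) <= C2,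
  \sum_v \sum_w A v w * (o v * o w) <= 2 * C2,
  \sum_v \sum_w A v w * (nS v * nS w) <= 6 * C2,
  \sum_v \sum_w A v w * (nL v * nS w * (1 - x v)) <= C2 &
  \sum_w (nS w * ((D w < k.-1)%N)%:R) * x w <= C2].
Proof.
have := edge_excess_bound; have := exceptional_weight.
have : 0 <= \sum_v \sum_w A v w * (n v * o w * (1 - x w)).
  by apply: sumA0 => v w; rewrite !mulr_ge0 ?ler0n // subr_ge0.
have : 0 <= \sum_v \sum_w A v w * (o v * o w).
  by apply: sumA0 => v w; rewrite !mulr_ge0 ?ler0n.
have : 0 <= \sum_v \sum_w A v w * (nS v * nS w).
  by apply: sumA0 => v w; rewrite !mulr_ge0 ?ler0n.
have : 0 <= \sum_v \sum_w A v w * (nL v * nS w * (1 - x v)).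
  by apply: sumA0 => v w; rewrite !mulr_ge0 ?ler0n // subr_ge0.
have : 0 <= \sum_w (nS w * ((D w < k.-1)%N)%:R) * x w.
  by apply: sumr_ge0 => w _; rewrite !mulr_ge0 ?ler0n.
rewrite /C2; move=> *; split; lra.
Qed.

Lemma outer_edge_bound (v w : V) : A v w * (n v * (o w * (1 - g w))) <=
  3 / 2 * (A v w * (n v * o w * (1 - x w))).
Proof.
have -> : 3 / 2 * (A v w * (n v * o w * (1 - x w))) =
   (A v w * n v * o w) * (3 / 2 * (1 - x w)) by ring.
have -> : A v w * (n v * (o w * (1 - g w))) = (A v w * n v * o w) * (1 - g w) by ring.
apply: ler_wpM2l; first by rewrite !mulr_ge0 ?ler0n.
rewrite /g; have := @entry_outside w; case: (w \in L) => /= H; first by have := x1 w; lra.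
by have := H isT; lra.
Qed.

(** Ordered edges between two neighbours of [u] give [6 C2], between two non-neighbours [2 C2], and
    mixed ones twice [3/2 C2]. *)
Lemma edges_out : \sum_v \sum_w A v w * ((1 - g v) * (1 - g w)) <= 11 * C2.
Proof.
have [Ba Bb Bd _ _] := bound_terms.
have Ba2 : \sum_v \sum_w A v w * (n v * (o w * (1 - g w))) <= 3 / 2 * C2.
  apply: (@le_trans _ _ (\sum_v \sum_w 3 / 2 * (A v w * (n v * o w * (1 - x w))))).
    by apply: ler_sum => v _; apply: ler_sum => w _; exact: outer_edge_bound.
  under eq_bigr do rewrite -big_distrr /=.
  by rewrite -big_distrr /= ler_pM2l // divr_gt0.
have : \sum_v \sum_w A v w * ((1 - g v) * (1 - g w)) <=
  \sum_v \sum_w A v w * (nS v * nS w) + \sum_v \sum_w A v w * (o v * o w)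
  + \sum_v \sum_w A v w * (n v * (o w * (1 - g w)) + n w * (o v * (1 - g v))).
  rewrite -!big_split; apply: ler_sum => v _ /=.
  rewrite -!big_split; apply: ler_sum => w _ /=.
  rewrite -!mulrDr; apply: ler_wpM2l => //.
  rewrite /g /nS /o /n; case: (E u v); case: (E u w); case: (v \in L); case: (w \in L) => /=;
  rewrite ?(mulr0, mul0r, mul1r, mulr1, add0r, addr0, subr0, subrr); lra.
rewrite -(edge_sum_sym (fun v w => n v * (o w * (1 - g w)))); lra.
Qed.

Let C3 : R := ell%:R + 11 * C2.

Lemma entry_outside_bound w : w \notin L -> l * x w <= C3.
Proof.
move=> wL; rewrite -ex /apply_form /C3.
apply: (@le_trans _ _ (\sum_v g v + \sum_v A w v * ((1 - g w) * (1 - g v)))).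
  rewrite -big_split; apply: ler_sum => v _ /=.
  have -> : g w = 0 by rewrite /g (negPf wL).
  rewrite /g /A; case: (E w v); case: (v \in L) => /=;
  rewrite ?(mulr0, mul0r, mul1r, mulr1, add0r, addr0, subr0, subrr) //; have := x1 v; lra.
apply: lerD; first exact: card_heavy_bound.
apply: le_trans edges_out; rewrite [leRHS](bigD1 w) //= lerDl.
apply: sumr_ge0 => v _; apply: sumr_ge0 => z _.
by rewrite !mulr_ge0 // /g; case: (_ \in L); rewrite ?subrr ?subr0.
Qed.

Let omega v := \sum_w A v w * (nS w * x w).

(** [ell] bounds the neighbours of [v] in [L], and [2 C2] those outside [L] not adjacent to [u];
    which of the [bound_terms] gives the latter depends on whether [v] is adjacent to [u]. *)
Lemma omega_lower v : l * x v <= ell%:R + 2 * C2 + omega v.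
Proof.
have [Ba Bb _ _ _] := bound_terms.
rewrite -ex /apply_form.
apply: (@le_trans _ _ (\sum_w (g w + A v w * (o w * (1 - g w)) + A v w * (nS w * x w)))).
  apply: ler_sum => w _; rewrite /A /g /o /nS; have := x0 w; have := x1 w.
  case: (E v w); case: (w \in L); case: (E u w) => /=;
  rewrite ?(mulr0, mul0r, mul1r, mulr1, add0r, addr0, subr0, subrr) //; lra.
rewrite !big_split /= -/(omega v); apply: lerD => //; apply: lerD; first exact: card_heavy_bound.
case: (boolP (E u v)) => uv.
  apply: (@le_trans _ _ (3 / 2 * \sum_w A v w * (n v * o w * (1 - x w)))).
    rewrite big_distrr; apply: ler_sum => w _ /=; have := outer_edge_bound v w.
    by rewrite /n uv !mul1r.
  have : \sum_w A v w * (n v * o w * (1 - x w)) <= C2.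
    apply: le_trans Ba; rewrite [leRHS](bigD1 v) //= lerDl.
    by do 2 (apply: sumr_ge0 => ? _); rewrite !mulr_ge0 ?ler0n // subr_ge0.
  by move: C20; lra.
apply: le_trans Bb; rewrite [leRHS](bigD1 v) //= -[leLHS]addr0; apply: lerD.
  apply: ler_sum => w _; apply: ler_wpM2l => //; rewrite {2}/o uv mul1r.
  by rewrite ler_piMr ?ler0n // /g lerBlDr lerDl ler0n.
by do 2 (apply: sumr_ge0 => ? _); rewrite !mulr_ge0 ?ler0n.
Qed.

Let C7 : R := 6 * C2 * C3.
Let C8 : R := C7 + ell%:R + 2 * C2.

Hypothesis l_large1 : 6 * (ell%:R + 2 * C2) <= l.

(** The [d] neighbours of [v] among those of [u] outside [L] supply [omega v >= l / 6] with entries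
    at most [C3 / l], so [d] has order at least [l^2]; yet [d (1 - x v) <= C2]. *)
Lemma entry_near1 v : v \in L -> E u v -> l ^+ 2 * (1 - x v) <= C7.
Proof.
move=> vL uv; have [_ _ _ Be _] := bound_terms.
pose d := \sum_w A v w * nS w.
have d1 : d * (1 - x v) <= C2.
  apply: le_trans Be; rewrite [leRHS](bigD1 v) //= -[leLHS]addr0; apply: lerD; last first.
    by do 2 (apply: sumr_ge0 => ? _); rewrite !mulr_ge0 ?ler0n // subr_ge0.
  rewrite /d big_distrl; apply: ler_sum => w _ /=.
  by rewrite /nL uv vL /= mul1r mulrA.
have d2 : l * omega v <= C3 * d.
  rewrite /omega /d !big_distrr; apply: ler_sum => w _ /=.
  rewrite /nS; case: (boolP (E u w)) => uw /=; last by rewrite !(mulr0, mul0r).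
  case: (boolP (w \in L)) => wL /=; first by rewrite !(mulr0, mul0r).
  have := entry_outside_bound wL; have := A0 v w; nra.
have d3 : l <= 6 * omega v.
  have := omega_lower v; move: vL; rewrite inE; move: l1 l_large1; nra.
have C30 : 0 <= C3 by rewrite /C3 addr_ge0 ?ler0n // mulr_ge0.
have y0 : 0 <= 1 - x v by rewrite subr_ge0.
apply: (@le_trans _ _ (6 * (C3 * (d * (1 - x v))))); last first.
  by rewrite /C7 -mulrA [C2 * C3]mulrC ler_pM2l // ler_wpM2l.
have -> : 6 * (C3 * (d * (1 - x v))) = 6 * (C3 * d) * (1 - x v) by ring.
apply: ler_wpM2r => //; rewrite expr2.
have : l * l <= l * (6 * omega v) by rewrite ler_pM2l // (lt_le_trans _ l1).
lra.
Qed.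

Let omega_u : omega u = \sum_w nS w * x w.
Proof.
apply: eq_bigr => w _; rewrite /A /nS; case: (E u w) => /=; by rewrite ?mul1r ?mul0r.
Qed.

Lemma omega_u_ge : l - ell%:R <= omega u.
Proof.
rewrite omega_u lerBlDr [leLHS]lambda_at_u.
apply: (@le_trans _ _ (\sum_w (nS w * x w + g w))).
  apply: ler_sum => w _; rewrite /n /nS /g; have := x1 w; have := x0 w.
  case: (E u w); case: (w \in L) => /=;
  rewrite ?(mulr0, mul0r, mul1r, mulr1, add0r, addr0, subr0, subrr) //; lra.
by rewrite big_split /= lerD2l card_heavy_bound.
Qed.

(** [omega u <= l], whereas [omega v >= l - O(1)] because [x v] is close to 1. *)
Lemma missing_weight v : v \in L -> E u v ->
  \sum_w (1 - A v w) * (nS w * x w) <= C8.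
Proof.
move=> vL uv.
have -> : \sum_w (1 - A v w) * (nS w * x w) = omega u - omega v.
  rewrite omega_u /omega -sumrN -big_split; apply: eq_bigr => w _ /=; ring.
have ul : omega u <= l.
  rewrite omega_u lambda_at_u; apply: ler_sum => w _; apply: ler_wpM2r => //.
  by rewrite /nS /n; case: (E u w); case: (w \in L) => /=.
have H := omega_lower v; have H7 := entry_near1 vL uv.
have : l * (1 - x v) <= l ^+ 2 * (1 - x v).
  apply: ler_wpM2r; first by rewrite subr_ge0.
  by rewrite expr2 ler_peMl // (le_trans _ l1).
rewrite /C8; lra.
Qed.

(** Entries are at most 1, so the weight that survives all adjacency conditions bounds a number of
    vertices from below. This is how large weight produces a forbidden biclique. *)
Lemma common_weight v0 (T : {set V}) : T \subset L -> (forall v, v \in T -> E u v) ->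
  omega v0 - #|T|%:R * C8 <= (#|common_nbrs E (v0 |: (u |: T))|%:R : R).
Proof.
move=> TL Tu.
have : \sum_(v in T) \sum_w (1 - A v w) * (nS w * x w) <= #|T|%:R * C8.
  rewrite mulr_natl -sumr_const; apply: ler_sum => v vT.
  by apply: missing_weight; [exact: (subsetP TL) | exact: Tu].
suff : omega v0 <= #|common_nbrs E (v0 |: (u |: T))|%:R +
   \sum_(v in T) \sum_w (1 - A v w) * (nS w * x w) by lra.
rewrite -sum1_card natr_sum exchange_big big_mkcond -big_split; apply: ler_sum => w _ /=.
have F0 v : 0 <= (1 - A v w) * (nS w * x w).
  by rewrite mulr_ge0 // ?mulr_ge0 ?ler0n // subr_ge0 lern1 leq_b1.
have S0 (P : pred V) : 0 <= \sum_(v in T | P v) (1 - A v w) * (nS w * x w).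
  by apply: sumr_ge0.
have S0' : 0 <= \sum_(v in T) (1 - A v w) * (nS w * x w) by apply: sumr_ge0.
case: ifPn => [_|].
  apply: (@le_trans _ _ 1); last by rewrite lerDl.
  rewrite mulrA mulr_ile1 ?mulr_ge0 ?ler0n //.
  by rewrite /A /nS -natrM lern1; case: (E v0 w); case: (_ && _).
rewrite common_nbrsU1 common_nbrsU1 add0r.
case: (boolP (E v0 w)) => vw0 /=; last by move=> _; rewrite {1}/A (negPf vw0) mul0r.
case: (boolP (E u w)) => uw /=; last by move=> _; rewrite {1}/nS (negPf uw) mul0r mulr0.
move=> H; have [v vT vw] : exists2 v, v \in T & ~~ E v w.
  by move: H; rewrite inE negb_forall_in => /exists_inP[v vT vw]; exists v.
have -> : A v0 w = 1 by rewrite /A vw0.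
rewrite (bigD1 v) //=; have -> : A v w = 0 by rewrite /A (negPf vw).
by rewrite subr0 !mul1r lerDl.
Qed.

Hypothesis l_large2 : 3 * (b%:R + 2 * (ell%:R + C2) + k%:R * C8) < l.

Let NL := [set v in L | E u v].

(** With [k] heavy neighbours, [u] and these would have about [l] common neighbours. With fewer than
    [k - 1], every neighbour of [u] outside [L] has [D w < k - 1], so all of [omega u] would be
    exceptional weight, which is bounded. *)
Lemma card_heavy_nbrs : #|NL| = k.-1.
Proof.
have C80 : 0 <= C8.
  by rewrite /C8 /C7 /C3 !addr_ge0 ?mulr_ge0 ?addr_ge0 ?mulr_ge0 ?ler0n.
have kC8 : 0 <= k%:R * C8 by rewrite mulr_ge0.
have := ler0n R b; have e0 := ler0n R ell => b0.
apply/eqP; rewrite eqn_leq; apply/andP; split.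
  rewrite leqNgt; apply/negP; rewrite (prednK k0) => /subset_of_card[T TN Tk].
  have TL : T \subset L.
    by apply: subset_trans TN _; apply/subsetP => v; rewrite inE => /andP[].
  have Tu v : v \in T -> E u v by move/(subsetP TN); rewrite inE => /andP[].
  have := common_weight u TL Tu; rewrite setUA setUid Tk.
  have uT : u \notin T by apply/negP => /Tu; rewrite irrE.
  have : #|u |: T| = k.+1 by rewrite cardsU1 uT Tk.
  move/free => H; have : (#|common_nbrs E (u |: T)|%:R : R) <= b%:R by rewrite ler_nat ltnW.
  have := omega_u_ge; move: C20 l_large2; lra.
rewrite leqNgt; apply/negP => small.
have [_ _ _ _ Bc] := bound_terms.
have : omega u <= C2.
  rewrite omega_u; apply: le_trans Bc; apply: ler_sum => w _.
  suff -> : (D w < k.-1)%N by rewrite mulr1.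
  apply: leq_ltn_trans small; apply/subset_leq_card/subsetP => v.
  by rewrite !inE => /and3P[-> ->].
have := omega_u_ge; move: C20 l_large2; lra.
Qed.

(** A further heavy [v] has [omega v >= l / 3 - O(1)]; together with [u] and [NL] it would form a
    set of [k + 1] vertices with too many common neighbours. *)
Lemma heavy_eq : L = u |: NL.
Proof.
have C80 : 0 <= C8.
  by rewrite /C8 /C7 /C3 !addr_ge0 ?mulr_ge0 ?addr_ge0 ?mulr_ge0 ?ler0n.
have := ler0n R b; have e0 := ler0n R ell => b0.
apply/eqP; rewrite eqEsubset; apply/andP; split; last first.
  apply/subsetP => v; rewrite in_setU1 => /orP[/eqP ->|]; first exact: heavy_u.
  by rewrite inE => /andP[].
apply/subsetP => v vL; rewrite in_setU1 inE vL /=; case: eqVneq => //= vu.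
apply/negPn/negP => uv.
have TL : NL \subset L by apply/subsetP => w; rewrite inE => /andP[].
have Tu w : w \in NL -> E u w by rewrite inE => /andP[].
have := common_weight v TL Tu.
have : #|v |: (u |: NL)| = k.+1.
  rewrite !cardsU1 card_heavy_nbrs in_setU1 negb_or vu [in v \in _]inE [in u \in _]inE irrE.
  by rewrite (negPf uv) !andbF /= !add1n (prednK k0).
move/free => H; have : (#|common_nbrs E (v |: (u |: NL))|%:R : R) <= b%:R by rewrite ler_nat ltnW.
have := omega_lower v; rewrite card_heavy_nbrs.
have : k.-1%:R * C8 <= k%:R * C8 by apply: ler_wpM2r => //; rewrite ler_nat leq_pred.
move: vL; rewrite inE; move: C20 l_large2 l1; nra.
Qed.

Lemma card_heavy : #|L| = k.
Proof. by rewrite heavy_eq cardsU1 card_heavy_nbrs inE irrE andbF /= add1n (prednK k0). Qed.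

Lemma entry_near1_heavy v : v \in L -> l ^+ 2 * (1 - x v) <= C7.
Proof.
move=> vL; have := vL; rewrite heavy_eq in_setU1 => /orP[/eqP ->|]; last first.
  by rewrite inE => /andP[_ uv]; exact: entry_near1.
rewrite xu subrr mulr0 /C7 /C3.
by rewrite !mulr_ge0 ?addr_ge0 ?mulr_ge0 ?ler0n.
Qed.

(** If [w] is adjacent to [u], then [x w >= 1 / l] and some vertex of [NL] misses [w], so
    [missing_weight] allows [O(l)] such [w]. Otherwise an edge joins [w] to a neighbour of [u], and
    there are boundedly many of these. *)
Lemma deficient_count :
  (#|[set w | w \notin L & (0 < #|[set v in L | E v w]| < k)%N]|%:R : R)
  <= l * (k%:R * C8 + 3 / 2 * C2).
Proof.
have C80 : 0 <= C8.
  by rewrite /C8 /C7 /C3 !addr_ge0 ?mulr_ge0 ?addr_ge0 ?mulr_ge0 ?ler0n.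
have [Ba _ _ _ _] := bound_terms.
have Ba2 : \sum_v \sum_w A v w * (n v * (o w * (1 - g w))) <= 3 / 2 * C2.
  apply: (@le_trans _ _ (\sum_v \sum_w 3 / 2 * (A v w * (n v * o w * (1 - x w))))).
    by apply: ler_sum => v _; apply: ler_sum => w _; exact: outer_edge_bound.
  under eq_bigr do rewrite -big_distrr /=.
  by rewrite -big_distrr /= ler_pM2l // divr_gt0.
have M1 : \sum_(v in NL) \sum_w (1 - A v w) * (nS w * x w) <= k%:R * C8.
  apply: (@le_trans _ _ (#|NL|%:R * C8)).
    rewrite mulr_natl -sumr_const; apply: ler_sum => v.
    by rewrite inE => /andP[vL uv]; exact: missing_weight.
  by apply: ler_wpM2r => //; rewrite ler_nat card_heavy_nbrs leq_pred.
set X := [set w | _].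
have l0 : 0 <= l by rewrite (le_trans _ l1).
have : (#|X|%:R : R) <= l * (\sum_(v in NL) \sum_w (1 - A v w) * (nS w * x w))
  + \sum_v \sum_w A v w * (n v * (o w * (1 - g w))).
  rewrite exchange_big [X in _ + X]exchange_big big_distrr /= -big_split.
  rewrite -sum1_card natr_sum big_mkcond; apply: ler_sum => w _ /=.
  have F0 v : 0 <= (1 - A v w) * (nS w * x w).
    by rewrite mulr_ge0 // ?mulr_ge0 ?ler0n // subr_ge0 lern1 leq_b1.
  have G0 v : 0 <= A v w * (n v * (o w * (1 - g w))).
    by rewrite !mulr_ge0 ?ler0n // /g; case: (w \in L); rewrite ?subrr ?subr0.
  have SF (P : pred V) : 0 <= \sum_(v | P v) (1 - A v w) * (nS w * x w) by apply: sumr_ge0.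
  have SG (P : pred V) : 0 <= \sum_(v | P v) A v w * (n v * (o w * (1 - g w))) by apply: sumr_ge0.
  case: ifPn => [|_]; last by rewrite addr_ge0 // mulr_ge0.
  rewrite inE => /and3P[wL d0 dk].
  case: (boolP (E u w)) => uw.
    have [v vL vw] : exists2 v, v \in L & ~~ E v w.
      move: dk; rewrite -card_heavy => dk; apply/exists_inP; rewrite -negb_forall_in.
      apply: contraL dk => /forall_inP H; rewrite -leqNgt; apply/subset_leq_card/subsetP => v vL.
      by rewrite inE vL H.
    have vN : v \in NL.
      move: vL; rewrite {1}heavy_eq in_setU1 => /orP[/eqP vu|//].
      by move: vw; rewrite vu uw.
    rewrite (bigD1 v) //= /A (negPf vw) subr0 mul1r {1}/nS uw wL mul1r -/A.
    have lx : 1 <= l * x w.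
      rewrite -ex /apply_form (bigD1 u) //= /A symE uw xu mulr1 lerDl.
      by apply: sumr_ge0 => ? _; rewrite mulr_ge0.
    rewrite mulrDr -addrA; apply: le_trans lx _; rewrite lerDl addr_ge0 //.
    by rewrite mulr_ge0.
  have [v] := card_gt0P d0; rewrite inE => /andP[vL vw].
  have uv : E u v.
    move: vL; rewrite heavy_eq in_setU1 => /orP[/eqP vu|]; last by rewrite inE => /andP[].
    by move: uw; rewrite -vu vw.
  rewrite [X in _ <= _ + X](bigD1 v) //=.
  have -> : A v w * (n v * (o w * (1 - g w))) = 1.
    by rewrite /A vw /n uv /o uw /g (negPf wL) subr0 !mul1r.
  by rewrite addrCA lerDl addr_ge0 ?mulr_ge0.
have : l * (\sum_(v in NL) \sum_w (1 - A v w) * (nS w * x w)) <= l * (k%:R * C8).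
  exact: ler_wpM2l.
have : 3 / 2 * C2 <= l * (3 / 2 * C2) by rewrite ler_peMl // mulr_ge0 // divr_ge0.
lra.
Qed.

End Stability.

Lemma stability (R : realType) (k b : nat) : (0 < k)%N ->
  exists2 C : R, 1 <= C &
  forall (V : finType) (E : rel V) (x : V -> R) (l : R) (u : V),
  simple_graph E -> biclique_free E k.+1 b ->
  (forall v, apply_form (fun v w => (E v w)%:R) x v = l * x v) ->
  (forall v, 0 <= x v <= 1) -> x u = 1 -> C <= l ->
  (nedges E)%:R - (k ^ 2)%:R <= l ^+ 2 - k.-1%:R * l ->
  (nedges E)%:R <= 2 * l ^+ 2 ->
  exists L : {set V}, [/\ #|L| = k, forall v, v \in L -> l ^+ 2 * (1 - x v) <= C,
    forall w, w \notin L -> l * x w <= C,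
    \sum_(v | v \notin L) \sum_(w | w \notin L) ((E v w)%:R : R) <= C &
    (#|[set w | w \notin L & (0 < #|[set v in L | E v w]| < k)%N]|%:R : R) <= l * C].
Proof.
move=> k0.
(* The factor 9 is the inverse square of the threshold [1/3]; the other factor is the bound on
   [normsq x] with [a = k + 1]. *)
pose ell := (9 * (16 * k.+1 + 8 * b * 32 ^ k.+1))%N.
pose C0 : R := (k ^ 2)%:R.
have C00 : 0 <= C0 by exact: ler0n.
pose C2 : R := C0 + ell%:R ^+ 2 + ell%:R * (b * 2 ^ ell)%:R.
pose C3 : R := ell%:R + 11 * C2.
pose C7 : R := 6 * C2 * C3.
pose C8 : R := C7 + ell%:R + 2 * C2.
have e0 : 0 <= (ell%:R : R) by exact: ler0n.
have b0 : 0 <= (b%:R : R) by exact: ler0n.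
have C20 : 0 <= C2 by rewrite /C2 !addr_ge0 // ?mulr_ge0 ?ler0n // exprn_ge0 ?ler0n.
have C30 : 0 <= C3 by rewrite /C3 addr_ge0 // mulr_ge0.
have C70 : 0 <= C7 by rewrite /C7 !mulr_ge0.
have C80 : 0 <= C8 by rewrite /C8 !addr_ge0 // mulr_ge0.
have kC8 : 0 <= k%:R * C8 by rewrite mulr_ge0.
(* One constant serves as threshold for [l] and as bound in every conclusion, hence the sum. *)
pose C : R := 1 + 6 * (ell%:R + 2 * C2) + 3 * (b%:R + 2 * (ell%:R + C2) + k%:R * C8)
  + C7 + C3 + 11 * C2 + (k%:R * C8 + 3 / 2 * C2).
exists C => [|V E x l u gE free ex x01 xu Cl H1 H2]; first by rewrite /C; lra.
have [symE irrE] := gE.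
have x0 v : 0 <= x v by have /andP[] := x01 v.
have x1 v : x v <= 1 by have /andP[] := x01 v.
have l1 : 1 <= l by rewrite (le_trans _ Cl) // /C; lra.
have l0 : 0 < l by exact: lt_le_trans l1.
have NB := eigenvector_normsq_bound gE free ex x01 xu l0 H2.
pose L := [set v | 1 / 3 <= x v].
have Lell : (#|L| <= ell)%N.
  rewrite -(ler_nat R) -sum_indicator.
  apply: (@le_trans _ _ (9 * normsq x)).
    rewrite /normsq big_distrr; apply: ler_sum => v _ /=; rewrite inE.
    case: (leP (1 / 3) (x v)) => xv; last by rewrite mulr_ge0 // sqr_ge0.
    have : 1 / 3 * (1 / 3) <= x v * x v by rewrite ler_pM // divr_ge0.
    by rewrite mulr1n expr2; lra.
  by rewrite /ell natrM ler_pM2l // natrD !natrM natrX.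
have lC0 : (\sum_v \sum_w ((E v w)%:R : R)) / 2 - C0 <= l ^+ 2 - k.-1%:R * l.
  have -> : \sum_v \sum_w ((E v w)%:R : R) = 2 * (nedges E)%:R.
    rewrite -natrM -handshake // natr_sum; apply: eq_bigr => v _; by rewrite natr_sum.
  by rewrite [2 * _]mulrC mulfK // pnatr_eq0.
have ll1 : 6 * (ell%:R + 2 * C2) <= l by rewrite (le_trans _ Cl) // /C; lra.
have ll2 : 3 * (b%:R + 2 * (ell%:R + C2) + k%:R * C8) < l.
  by rewrite (lt_le_trans _ Cl) // /C; lra.
exists L; split.
- exact: (card_heavy k0 symE irrE free ex x0 x1 xu l1 lC0 C00 Lell ll1 ll2).
- move=> v vL; apply: le_trans (_ : _ <= C7) _; last by rewrite /C; lra.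
  exact: (entry_near1_heavy k0 symE irrE free ex x0 x1 xu l1 lC0 C00 Lell ll1 ll2).
- move=> w wL; apply: le_trans (_ : _ <= C3) _; last by rewrite /C; lra.
  exact: (entry_outside_bound k0 symE irrE free ex x0 x1 xu lC0 Lell).
- apply: le_trans (_ : _ <= 11 * C2) _; last by rewrite /C; lra.
  apply: le_trans (edges_out k0 symE irrE free ex x0 x1 xu lC0 Lell).
  rewrite big_mkcond; apply: ler_sum => v _; rewrite -/L; case: (v \in L) => /=.
    by apply: sumr_ge0 => w _; rewrite subrr mul0r mulr0.
  rewrite big_mkcond; apply: ler_sum => w _; case: (w \in L) => /=.
    by rewrite subrr !mulr0.
  by rewrite subr0 !mulr1.
- apply: le_trans (deficient_count k0 symE irrE free ex x0 x1 xu l1 lC0 C00 Lell ll1 ll2) _.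
  by rewrite ler_pM2l // -/C2 -/C3 -/C7 -/C8 /C; lra.
Qed.

(** * Comparison with the split graph *)

Section SplitGraphRecognition.
Variables (V : finType) (E : rel V) (k m : nat) (L F D S0 : {set V}).
Hypothesis symE : symmetric E.
Hypothesis k0 : (0 < k)%N.
Hypothesis Lk : #|L| = k.
Hypothesis Ft : #|F| = split_t k m.
Hypothesis S0L : S0 \subset L.
Hypothesis S0s : #|S0| = split_s k m.
Hypothesis FL : forall w, w \in F -> w \notin L.
Hypothesis DL : forall w, w \in D -> (w \notin L) && (w \notin F).
Hypothesis D1 : forall w w', w \in D -> w' \in D -> w = w'.
Hypothesis Ds : (0 < split_s k m)%N -> exists w, w \in D.
Hypothesis ELL : forall v w, v \in L -> w \in L -> E v w = (v != w).
Hypothesis ELF : forall v w, v \in L -> w \in F -> E v w.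
Hypothesis ELD : forall v w, v \in L -> w \in D -> E v w = (v \in S0).
Hypothesis Eout : forall v w, v \notin L -> w \notin L -> ~~ E v w.
Hypothesis FD : forall w, w \notin L -> nonisol E w -> (w \in F) || (w \in D).

(** [L] becomes the clique, [F] the independent vertices and the element of [D] the extra vertex.
    [D] may be empty when [s = 0], because the extra vertex is then isolated. *)
Lemma split_graph_recognition : isomorphic E (split_graph k m).
Proof.
set t := split_t k m; set s := split_s k m.
have sk : (s < k)%N by rewrite /s /split_s ltn_mod.
(* [S0] comes first, since [split_adj0] joins the extra vertex to the indices below [s]. *)
pose q := enum S0 ++ enum (L :\: S0).
have memq v : (v \in q) = (v \in L).
  rewrite mem_cat !mem_enum inE; case: (boolP (v \in S0)) => //= vS.
  by rewrite (subsetP S0L).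
have uq : uniq q.
  rewrite cat_uniq !enum_uniq andbT /=; apply/hasPn => v.
  by rewrite !mem_enum inE => /andP[].
have szq : size q = k.
  rewrite size_cat -!cardE -Lk -[in RHS](cardsID S0 L); congr (_ + _)%N.
  by rewrite (setIidPr S0L).
have q_lt v : v \in L -> (index v q < k)%N by rewrite -szq index_mem memq.
have q_s v : v \in L -> (index v q < s)%N = (v \in S0).
  move=> vL; rewrite index_cat mem_enum; case: ifP => vS.
    by rewrite /s -S0s cardE index_mem mem_enum.
  by rewrite /s -S0s cardE ltnNge leq_addr.
have F_lt v : v \in F -> (index v (enum F) < t)%N.
  by rewrite /t -Ft cardE index_mem mem_enum.
(* The default [k + t] is also taken at isolated vertices, so injectivity is proved on [P] only. *)
pose fn v := if v \in L then index v q else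
  if v \in F then (k + index v (enum F))%N else (k + t)%N.
have fn_lt v : (fn v < split_n k m)%N.
  rewrite /split_n -/t /fn; case: ifP => [/q_lt|_]; first lia.
  by case: ifP => [/F_lt|_]; lia.
pose f v := Ordinal (fn_lt v).
pose P v := [|| v \in L, v \in F | v \in D].
have nP v : nonisol E v -> P v.
  by rewrite /P => nv; case: (boolP (v \in L)) => //= vL; exact: FD.
have fnL v : v \in L -> fn v = index v q by rewrite /fn => ->.
have fnF v : v \in F -> fn v = (k + index v (enum F))%N.
  by move=> vF; rewrite /fn (negPf (FL vF)) vF.
have fnD v : v \in D -> fn v = (k + t)%N.
  by move=> /DL /andP[/negPf a /negPf b]; rewrite /fn a b.
have finj v w : P v -> P w -> fn v = fn w -> v = w.
  case/or3P => v1 /or3P[] w1.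
  - rewrite !fnL // => H; rewrite -(nth_index v (_ : v \in q)) ?memq // H nth_index //.
    by rewrite memq.
  - by rewrite fnL // fnF //; have := q_lt _ v1; lia.
  - by rewrite fnL // fnD //; have := q_lt _ v1; lia.
  - by rewrite fnF // fnL //; have := q_lt _ w1; lia.
  - rewrite !fnF // => /addnI H; rewrite -(nth_index v (_ : v \in enum F)) ?mem_enum //.
    by rewrite H nth_index // mem_enum.
  - by rewrite fnF // fnD //; have := F_lt _ v1; lia.
  - by rewrite fnD // fnL //; have := q_lt _ w1; lia.
  - by rewrite fnD // fnF //; have := F_lt _ w1; lia.
  - by move=> _; exact: D1.
have fE v w : P v -> P w -> E v w = split_graph k m (f v) (f w).
  move=> Pv Pw.
  have neq : (f v != f w) = (v != w).
    congr (~~ _); apply/eqP/eqP => [/(congr1 val) /= /finj -> //|-> //].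
  rewrite /split_graph neq /split_adj0 /= -/t -/s.
  case/or3P: (Pv) => v1; case/or3P: (Pw) => w1.
  - rewrite ELL // !fnL //; have := q_lt _ v1; have := q_lt _ w1 => -> ->.
    by rewrite /= andbT.
  - rewrite ELF // fnL // fnF //; have := q_lt _ v1; have := F_lt _ w1.
    have -> : v != w by apply: contraTneq v1 => ->; exact: FL.
    lia.
  - rewrite ELD // fnL // fnD // -q_s //; have := q_lt _ v1.
    have -> : v != w by apply: contraTneq v1 => ->; have /andP[] := DL w1.
    lia.
  - rewrite symE ELF // fnF // fnL //; have := q_lt _ w1; have := F_lt _ v1.
    have -> : v != w by apply: contraTneq w1 => <-; exact: FL.
    lia.
  - rewrite !fnF // (negPf (Eout (FL v1) (FL w1))).
    have := F_lt _ v1; have := F_lt _ w1; lia.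
  - have /andP[wL wF] := DL w1; rewrite (negPf (Eout (FL v1) wL)) fnF // fnD //.
    have := F_lt _ v1; lia.
  - rewrite symE ELD // fnD // fnL // -q_s //; have := q_lt _ w1.
    have -> : v != w by apply: contraTneq w1 => <-; have /andP[] := DL v1.
    lia.
  - have /andP[vL vF] := DL v1; rewrite (negPf (Eout vL (FL w1))) fnD // fnF //.
    have := F_lt _ w1; lia.
  - by rewrite (D1 v1 w1) eqxx /=; apply/negbTE/Eout; have /andP[] := DL w1.
have fsurj z : nonisol (split_graph k m) z -> exists2 v, P v & f v = z.
  case: z => i; rewrite {1}/split_n -/t => hi ni.
  have [ik|ki] := ltnP i k.
    have [v vL vi] : exists2 v, v \in L & index v q = i.
      have v0 : V by case: (q) szq => [|v ? _]; [rewrite /= => E0; move: k0; rewrite -E0|].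
      exists (nth v0 q i); first by rewrite -memq mem_nth ?szq.
      by rewrite index_uniq ?szq.
    by exists v; [rewrite /P vL | apply/val_inj; rewrite /= fnL].
  have [it|ti] := ltnP i (k + t)%N.
    have szF : size (enum F) = t by rewrite -cardE.
    have [v vF vi] : exists2 v, v \in F & index v (enum F) = (i - k)%N.
      have v0 : V.
        case: (enum F) szF => [|v ? _]; [rewrite /= => E0 | exact: v].
        by exfalso; move: it; rewrite -E0 addn0 ltnNge ki.
      exists (nth v0 (enum F) (i - k)); first by rewrite -mem_enum mem_nth ?szF; lia.
      by rewrite index_uniq ?enum_uniq // szF; lia.
    exists v; first by rewrite /P vF orbT.
    by apply/val_inj; rewrite /= fnF // vi subnKC.
  have ei : i = (k + t)%N by lia.
  have s0 : (0 < s)%N.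
    case/existsP: ni => -[j hj]; rewrite /split_graph /split_adj0 /= -/t -/s.
    by move: hj; rewrite /split_n -/t; lia.
  have [w wD] := Ds s0.
  exists w; first by rewrite /P wD !orbT.
  by apply/val_inj; rewrite /= fnD.
have symS : symmetric (split_graph k m).
  by move=> v w; rewrite /split_graph eq_sym orbC.
exists f; split; first by move=> v w /nP Pv /nP Pw /(congr1 val) /=; exact: finj.
split.
  move=> v nv; case/existsP: (nv) => w vw; apply/existsP; exists (f w).
  rewrite -fE //; first exact: nP.
  by apply/nP/existsP; exists v; rewrite symE.
split; last by move=> v w /nP Pv /nP Pw; exact: fE.
move=> z nz; have [v Pv vz] := fsurj _ nz; exists v; split=> //.
case/existsP: (nz) => z' zz'.
have [|w Pw wz] := fsurj z'; first by apply/existsP; exists z; rewrite symS.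
by apply/existsP; exists w; rewrite fE // vz wz.
Qed.

End SplitGraphRecognition.

(** * Arithmetic of the defect modulo [k] *)

Definition defect (k d : nat) : nat := (d * (k - d))%N.

(** The two defects exceed that of the sum by [2 a b] if [a + b < k], and by [2 (k - a) (k - b)]
    otherwise. *)
Lemma defect_mod_add k a b : (a < k)%N -> (b < k)%N ->
  (defect k ((a + b) %% k) + 2 * ((0 < a) && (0 < b)) <= defect k a + defect k b)%N.
Proof.
move=> ak bk; rewrite /defect.
have [abk|kab] := ltnP (a + b) k.
  rewrite modn_small //; have [c kE] : exists c, k = (a + b + c)%N.
    by exists (k - (a + b))%N; lia.
  subst k; rewrite (_ : a + b + c - (a + b) = c)%N; last lia.
  rewrite (_ : a + b + c - a = b + c)%N; last lia.
  rewrite (_ : a + b + c - b = a + c)%N; last lia.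
  case: a b {ak bk abk} => [|a] [|b]; rewrite ?andbF ?muln0 /=; nia.
have [c cE] : exists c, (a + b = k + c)%N by exists (a + b - k)%N; lia.
rewrite cE modnDl modn_small; last lia.
have [p kp] : exists p, (k = a + p)%N by exists (k - a)%N; lia.
have [q kq] : exists q, (k = b + q)%N by exists (k - b)%N; lia.
rewrite (_ : k - a = p)%N; last lia.
rewrite (_ : k - b = q)%N; last lia.
rewrite (_ : k - c = p + q)%N; last lia.
have p0 : (0 < p)%N by lia.
have q0 : (0 < q)%N by lia.
have -> : a = (c + q)%N by lia.
have -> : b = (c + p)%N by lia.
have := leq_b1 ((0 < c + q) && (0 < c + p))%N.
set e := nat_of_bool _; nia.
Qed.

Lemma defect_mod_sum k (V : finType) (P : pred V) (d : V -> nat) : (0 < k)%N ->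
  (forall w, P w -> d w < k)%N ->
  (defect k ((\sum_(w | P w) d w) %% k) <= \sum_(w | P w) defect k (d w))%N.
Proof.
move=> k0 dk; elim/big_rec2: _ => [|w y1 y2 wX IH]; first by rewrite mod0n.
rewrite -modnDmr; have := @defect_mod_add k (d w) (y2 %% k)%N (dk _ wX).
rewrite ltn_mod k0 => /(_ isT); lia.
Qed.

(** Each unit costs at most [defect k 1 = k - 1], less than the price [k] it has in
    [defect_extremal]; this gap forces [r = 0] there. *)
Lemma defect_mod_addr k a r : (0 < k)%N ->
  (defect k ((a + r) %% k) <= defect k (a %% k) + r * k.-1)%N.
Proof.
move=> k0; elim: r => [|r IH]; first by rewrite addn0 mul0n addn0.
rewrite addnS -addn1 -modnDml.
have [k1|k1] := leqP k 1.
  have -> : k = 1%N by lia.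
  by rewrite !modn1 /defect.
have := @defect_mod_add k ((a + r) %% k)%N 1%N; rewrite ltn_mod k0 k1 => /(_ isT isT).
have -> : defect k 1 = k.-1 by rewrite /defect mul1n subn1.
rewrite mulSn; lia.
Qed.

(* [d (k - d)] is subadditive modulo [k], strictly so on two nonzero residues. *)
Lemma defect_extremal k (V : finType) (X : {set V}) (d : V -> nat) (r s : nat) :
  (0 < k)%N -> (forall w, w \in X -> 0 < d w < k)%N ->
  ((\sum_(w in X) d w + r) %% k = s)%N ->
  (k * r + \sum_(w in X) defect k (d w) <= defect k s)%N ->
  r = 0%N /\ (#|X| <= 1)%N.
Proof.
move=> k0 dk sE H.
have dk' w : w \in X -> (d w < k)%N by move/dk/andP => [].
have r0 : r = 0%N.
  have := defect_mod_addr (\sum_(w in X) d w) r k0; rewrite sE.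
  have := defect_mod_sum k0 dk'; nia.
split=> //; rewrite leqNgt; apply/negP => /card_gt1P[w1 [w2 [w1X w2X w12]]].
move: H; rewrite r0 muln0 add0n -sE r0 addn0.
pose Y i := (i \in X) && (i != w1) && (i != w2).
have split_sum (G : V -> nat) :
    (\sum_(w in X) G w = G w1 + G w2 + \sum_(w | Y w) G w)%N.
  by rewrite (bigD1 w1) //= (bigD1 w2) /= ?addnA // w2X eq_sym.
rewrite !split_sum -modnDml -modnDmr.
have := @defect_mod_add k ((d w1 + d w2) %% k)%N ((\sum_(i | Y i) d i) %% k)%N.
rewrite !ltn_mod k0 => /(_ isT isT).
have := @defect_mod_add k (d w1) (d w2) (dk' _ w1X) (dk' _ w2X).
have /andP[-> _] := dk _ w1X; have /andP[-> _] := dk _ w2X.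
have : (defect k ((\sum_(i | Y i) d i) %% k) <= \sum_(i | Y i) defect k (d i))%N.
  by apply: defect_mod_sum => // w /andP[/andP[/dk']].
rewrite /=; lia.
Qed.

(** [J] counts ordered non-adjacent pairs in [L], [r2] ordered edges outside [L], [sd] and [sd2] sum
    [d] and [d^2] over the deficient vertices, and [T = t - |F|]. As [T = O(l)] and
    [1 - X2 / k^2 = O(l^-2)], replacing [X2] by [k^2] costs [O(1/l)]; [count] then eliminates
    [T]. *)
Lemma endgame_arithmetic (R : realType) (k l C J r2 sd sd2 s T X2 Z2 : R) :
  1 <= k ->
  1 <= C ->
  0 <= J ->
  J <= k ^+ 2 ->
  0 <= r2 ->
  r2 <= C ->
  0 <= s ->
  s <= k ->
  0 <= sd ->
  sd <= k * (l * C) ->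
  X2 <= k ^+ 2 ->
  k ^+ 2 * (1 - 2 * (C / l ^+ 2)) <= X2 ->
  s ^+ 2 * (1 - 2 * (C / l ^+ 2)) <= Z2 ->
  l * (J / 2) + T * X2 + Z2 - sd2 - C ^+ 3 / l <= 0 ->
  2 * k * T = 2 * sd + r2 - J - 2 * s ->
  1 <= l ->
  k + 2 * k ^+ 2 + 1 <= l ->
  4 * (2 * k ^+ 2 * C + 2 * k ^+ 2 * C * (2 * k * C + C + k ^+ 2 + 2 * k) + C ^+ 3) <= l ->
  sd2 <= k * sd ->
  J < 1 /\ k * r2 / 2 + k * sd - sd2 - (k * s - s ^+ 2) <= 1 / 4 + k * J / 2.
Proof.
move=> k1 C1 J0 Jk r0 rC s0 sk sd0 sdC X2k X2d Z2d main count l1.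
(* [l * C'] bounds the absolute value of [T], and [C'' / l] collects all errors, at most [1/4] in
   total. *)
set C' := 2 * k * C + C + _ + _; set C'' := _ + C ^+ 3 => H1 H2 H3.
have H : l * J / 2 - k * J / 2 + k * r2 / 2 + k * sd - sd2 - (k * s - s ^+ 2) <= C'' / l.
  have l0 : 0 < l by exact: lt_le_trans l1.
  pose i := l^-1; have i0 : 0 < i by rewrite invr_gt0.
  have il : i * l = 1 by rewrite /i mulVf // gt_eqF.
  have i1 : i <= 1 by rewrite /i invf_le1.
  have dE : C / l ^+ 2 = C * i * i by rewrite /i; field; rewrite gt_eqF.
  have k0 : 0 <= k by lra.
  have C0 : 0 <= C by lra.
  have kk0 : 0 <= k ^+ 2 by exact: sqr_ge0.
  have kC : 0 <= k * C by rewrite mulr_ge0.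
  have Tabs : `|T| <= l * C'.
    have H : `|2 * k * T| <= l * C'.
      rewrite count ler_norml /C'.
      have : C <= l * C by rewrite ler_peMl.
      have : k ^+ 2 <= l * k ^+ 2 by rewrite ler_peMl.
      have : k <= l * k by rewrite ler_peMl.
      have : 0 <= l * (k * C) by rewrite mulr_ge0 // ltW.
      have : k * (l * C) = l * (k * C) by ring.
      move: sdC; move=> *; apply/andP; split; lra.
    apply: le_trans H; rewrite normrM ler_peMl // ger0_norm; lra.
  have TX : T * k ^+ 2 - 2 * k ^+ 2 * C * C' * i <= T * X2.
    have D0 : 0 <= k ^+ 2 - X2 by lra.
    have D1 : k ^+ 2 - X2 <= 2 * k ^+ 2 * (C * i * i) by move: X2d; rewrite dE; lra.
    have : T * (k ^+ 2 - X2) <= l * C' * (2 * k ^+ 2 * (C * i * i)).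
      apply: (@le_trans _ _ (`|T| * (k ^+ 2 - X2))).
        by apply: ler_wpM2r => //; exact: ler_norm.
      by apply: ler_pM => //; rewrite normr_ge0.
    have -> : l * C' * (2 * k ^+ 2 * (C * i * i)) = (i * l) * (2 * k ^+ 2 * C * C' * i) by ring.
    by rewrite il mul1r; lra.
  have ZZ : s ^+ 2 - 2 * k ^+ 2 * C * i <= Z2.
    have : s ^+ 2 * (C * i * i) <= k ^+ 2 * (C * i).
      apply: ler_pM; first exact: sqr_ge0.
      - by rewrite !mulr_ge0 // ltW.
      - by rewrite ler_sqr.
      by rewrite ler_piMr // mulr_ge0 // ltW.
    by move: Z2d; rewrite dE; lra.
  have kT : k ^+ 2 * T = k * (2 * sd + r2 - J - 2 * s) / 2.
    by rewrite -count; field.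
  rewrite -/i in main *; move: main TX ZZ kT; rewrite /C''; lra.
have l0 : 0 < l by exact: lt_le_trans l1.
have : C'' / l <= 1 / 4 by rewrite ler_pdivrMr //; lra.
have lJ : 0 <= l * J by rewrite mulr_ge0 // ltW.
move=> Hb; split; last by lra.
(* [J >= 1] would cost at least [(l - k) / 2], more than the [k^2 + 1/4] available. *)
rewrite ltNge; apply/negP => J1.
have : 0 <= k * r2 by rewrite mulr_ge0 //; lra.
have : k * s <= k ^+ 2 by rewrite expr2 ler_wpM2l //; lra.
have : 0 <= s ^+ 2 by exact: sqr_ge0.
have : l - k <= (l - k) * J by rewrite ler_peMr //; have := sqr_ge0 k; lra.
lra.
Qed.

Lemma sum_ord_enum (R : pzRingType) (V : finType) (L : {set V}) (v0 : V) (k : nat)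
    (F : V -> R) : #|L| = k ->
  \sum_(i < k) F (nth v0 (enum L) i) = \sum_(v in L) F v.
Proof. by move=> <-; rewrite -[RHS]big_enum /= (big_nth v0) -cardE big_mkord. Qed.

(** The edge counts of both graphs equated, with products as opaque naturals to keep the problem
    linear. *)
Lemma balance_edges (c2 m kt kF s sd r J e kk : nat) :
  (c2 <= m -> c2 * 2 = kk -> m - c2 = kt + s -> e + J = kk ->
  2 * m = e + 2 * (kF + sd) + r -> 2 * kF + 2 * sd + r = 2 * kt + 2 * s + J)%N.
Proof. lia. Qed.

Lemma balance_half (kt kF s sd r : nat) :
  (2 * kF + 2 * sd + r = 2 * kt + 2 * s ->
  exists2 q, r = 2 * q & kF + (sd + q) = kt + s)%N.
Proof. by move=> H; exists (kt + s - (kF + sd))%N; lia. Qed.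

Lemma ltn_double_succ a b : (2 * a < 2 * b + 1 -> a <= b)%N.
Proof. lia. Qed.

(** * Comparison of the two Rayleigh quotients *)

Section Endgame.
Variables (R : realType) (V : finType) (E : rel V) (k : nat) (L : {set V}).
Variables (x : V -> R) (l C : R).
Hypothesis symE : symmetric E.
Hypothesis irrE : irreflexive E.
Hypothesis k0 : (0 < k)%N.
Hypothesis Lk : #|L| = k.
Let A v w : R := (E v w)%:R.
Hypothesis ex : forall v, apply_form A x v = l * x v.
Hypothesis x0 : forall v, 0 <= x v.
Hypothesis x1 : forall v, x v <= 1.
Hypothesis l1 : 1 <= l.
Hypothesis C1 : 1 <= C.
Hypothesis xL : forall v, v \in L -> l ^+ 2 * (1 - x v) <= C.
Hypothesis xO : forall w, w \notin L -> l * x w <= C.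
Let m := nedges E.
Let t := split_t k m.
Let s := split_s k m.
Let d w := #|[set v in L | E v w]|.
Let F := [set w | (w \notin L) && (d w == k)].
Let D := [set w | w \notin L & (0 < d w < k)%N].
Hypothesis DC : (#|D|%:R : R) <= l * C.
Hypothesis OC : \sum_(v | v \notin L) \sum_(w | w \notin L) ((E v w)%:R : R) <= C.
Hypothesis lam : lambda R (split_graph k m) <= l.
Hypothesis km : ('C(k, 2) <= m)%N.
Let K : R := k%:R.
Hypothesis large1 : K + 2 * K ^+ 2 + 1 <= l.
Hypothesis large2 :
  4 * (2 * K ^+ 2 * C + 2 * K ^+ 2 * C * (2 * K * C + C + K ^+ 2 + 2 * K) + C ^+ 3) <= l.

Let gg w := \sum_(v in L) A v w * x v.
Let X := \sum_(v in L) x v.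
Let Q := \sum_(v in L) x v ^+ 2.
Let LL := \sum_(v in L) \sum_(w in L) A v w * (x v * x w).
Let OO := \sum_(v | v \notin L) \sum_(w | w \notin L) A v w * (x v * x w).
Let G2 := \sum_(w | w \notin L) gg w ^+ 2.
Let J := (\sum_(v in L) \sum_(w in L) ((v != w) && ~~ E v w))%N.
Let r2 := (\sum_(v | v \notin L) \sum_(w | w \notin L) E v w)%N.
Let sd := (\sum_(w in D) d w)%N.
Let sd2 := (\sum_(w in D) d w ^ 2)%N.
Let delta : R := C / l ^+ 2.

Let l0 : 0 < l. Proof. exact: lt_le_trans l1. Qed.
Let Asym v w : A v w = A w v. Proof. by rewrite /A symE. Qed.
Let A0 v w : 0 <= A v w. Proof. exact: ler0n. Qed.
Let K1 : 1 <= K. Proof. by rewrite /K ler1n. Qed.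

Let delta0 : 0 <= delta.
Proof. by rewrite /delta divr_ge0 ?exprn_ge0 ?(ltW l0) // (le_trans _ C1). Qed.

Let delta4 : 4 * delta <= 1.
Proof.
rewrite /delta mulrA ler_pdivrMr ?exprn_gt0 // mul1r.
have C0 : 0 <= C by rewrite (le_trans _ C1).
have K0 : 0 <= K by rewrite (le_trans _ K1).
have H : 4 * C <= l.
  apply: le_trans large2.
  have : 0 <= 2 * K ^+ 2 * C * (2 * K * C + C + K ^+ 2 + 2 * K).
    by rewrite !mulr_ge0 ?addr_ge0 ?mulr_ge0 ?exprn_ge0.
  have : 0 <= C ^+ 3 by rewrite exprn_ge0.
  have : C <= K ^+ 2 * C by rewrite ler_peMl // expr2 mulr_ege1.
  move: C0; lra.
apply: le_trans H _; rewrite expr2 ler_peMl //; exact: ltW.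
Qed.

Let xLd v : v \in L -> 1 - delta <= x v.
Proof.
move=> vL; have := xL vL; rewrite -ler_pdivlMl ?exprn_gt0 // mulrC -/delta; lra.
Qed.

(** Completing the square bounds [2 x w gg w - l x w^2] by [gg w^2 / l] outside [L]. The test vector
    of [split_rayleigh] is the equality case, so the two estimates match term by term. *)
Lemma eigen_split : l * Q <= LL + l^-1 * G2 + OO.
Proof.
have q1 : l * normsq x = LL + 2 * (\sum_(w | w \notin L) x w * gg w) + OO.
  have -> : l * normsq x = qform A x.
    rewrite qformE /normsq big_distrr; apply: eq_bigr => v _; rewrite ex /=; ring.
  rewrite /qform (bigID (mem L)) /=.
  under eq_bigr do rewrite (bigID (mem L)) /=.
  rewrite big_split /=.
  under [X in _ + X = _]eq_bigr do rewrite (bigID (mem L)) /=.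
  rewrite big_split /= -/LL -/OO.
  have -> : \sum_(v in L) \sum_(w | w \notin L) A v w * (x v * x w) =
     \sum_(w | w \notin L) x w * gg w.
    rewrite exchange_big; apply: eq_bigr => w _; rewrite /gg big_distrr.
    by apply: eq_bigr => v _ /=; ring.
  have -> : \sum_(v | v \notin L) \sum_(w in L) A v w * (x v * x w) =
     \sum_(w | w \notin L) x w * gg w.
    apply: eq_bigr => w _; rewrite /gg big_distrr.
    by apply: eq_bigr => v _ /=; rewrite [A w v]Asym; ring.
  ring.
have q2 : 2 * (\sum_(w | w \notin L) x w * gg w) - l * \sum_(w | w \notin L) x w ^+ 2
   <= l^-1 * G2.
  rewrite /G2 !big_distrr -sumrN -big_split; apply: ler_sum => w _ /=.
  have : 0 <= l^-1 * (gg w - l * x w) ^+ 2 by rewrite mulr_ge0 ?sqr_ge0 ?invr_ge0 ?ltW.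
  have -> : l^-1 * (gg w - l * x w) ^+ 2 =
    l^-1 * gg w ^+ 2 - (l^-1 * l) * 2 * (x w * gg w) + (l^-1 * l) * (l * x w ^+ 2) by ring.
  rewrite mulVf ?gt_eqF // !mul1r; lra.
move: q1; rewrite /normsq (bigID (mem L)) /= -/Q; lra.
Qed.

(** The entries of [x] on [L] are placed on the clique in the order of [enum L]; [Z] sums the first
    [s] of them, each at least [1 - delta]. *)
Lemma split_side : exists2 Z : R, s%:R ^+ 2 * (1 - 2 * delta) <= Z ^+ 2 &
  X ^+ 2 - Q + l^-1 * (t%:R * X ^+ 2 + Z ^+ 2) <= l * Q.
Proof.
have [v0 v0L] : exists v, v \in L by apply/card_gt0P; rewrite Lk.
pose z i := x (nth v0 (enum L) i).
have zd i : (i < k)%N -> 1 - delta <= z i.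
  by move=> ik; apply: xLd; rewrite -mem_enum mem_nth // -cardE Lk.
have := split_rayleigh z k0 lam l0; rewrite -/t -/s.
set Z := \sum_(i < k) _ * _.
have -> : \sum_(i < k) z i = X by rewrite (sum_ord_enum _ x).
have -> : \sum_(i < k) z i ^+ 2 = Q by rewrite (sum_ord_enum _ (fun v => x v ^+ 2)).
have -> : \sum_(i < k) \sum_(j < k | j != i) z i * z j = X ^+ 2 - Q.
  have -> : X = \sum_(i < k) z i by rewrite (sum_ord_enum _ x).
  have -> : Q = \sum_(i < k) z i ^+ 2 by rewrite (sum_ord_enum _ (fun v => x v ^+ 2)).
  rewrite expr2 big_distrlr -sumrN -big_split; apply: eq_bigr => i _ /=.
  by rewrite [in RHS](bigD1 i) //= expr2 addrAC subrr add0r.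
move=> H; exists Z => //.
have sZ : s%:R * (1 - delta) <= Z.
  have -> : (s%:R : R) = \sum_(i < k) (i < s)%N%:R.
    have sk : (s <= k)%N by rewrite ltnW // /s /split_s ltn_mod.
    transitivity (\sum_(i < k | (i < s)%N) (1 : R)).
      by rewrite -(big_ord_widen k (fun=> 1)) // sumr_const card_ord.
    by rewrite big_mkcond; apply: eq_bigr => i _; case: ifP.
  rewrite big_distrl; apply: ler_sum => i _ /=.
  by apply: ler_wpM2l; [exact: ler0n | exact: zd].
have d1 : 0 <= 1 - delta by move: delta4 delta0; lra.
apply: (@le_trans _ _ ((s%:R * (1 - delta)) ^+ 2)); last first.
  by rewrite ler_sqr // ?nnegrE ?(le_trans _ sZ) // mulr_ge0.
rewrite exprMn; apply: ler_wpM2l; first exact: sqr_ge0.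
by have := sqr_ge0 delta; lra.
Qed.

Lemma X_bounds : K ^+ 2 * (1 - 2 * delta) <= X ^+ 2 /\ X ^+ 2 <= K ^+ 2.
Proof.
have d1 : 0 <= 1 - delta by move: delta4 delta0; lra.
have K0 : 0 <= K by rewrite (le_trans _ K1).
have X0 : 0 <= X by apply: sumr_ge0.
have Xl : K * (1 - delta) <= X.
  rewrite /X /K -Lk mulr_natl -sumr_const; apply: ler_sum => v; exact: xLd.
have Xu : X <= K.
  rewrite /X /K -Lk -[leRHS]mulr1 mulr_natl -sumr_const; exact: ler_sum.
split; last by rewrite ler_sqr.
apply: (@le_trans _ _ ((K * (1 - delta)) ^+ 2)).
  rewrite exprMn; apply: ler_wpM2l; first exact: sqr_ge0.
  by have := sqr_ge0 delta; lra.
by rewrite ler_sqr // nnegrE mulr_ge0.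
Qed.

(** The right side sums [x v * x w] over the pairs counted by [J], and each product is at least
    [(1 - delta)^2 >= 1/2]. *)
Lemma nonedges_weight : J%:R / 2 <= X ^+ 2 - Q - LL.
Proof.
have -> : X ^+ 2 - Q - LL =
  \sum_(v in L) \sum_(w in L) ((v != w) && ~~ E v w)%:R * (x v * x w).
  have -> : Q = \sum_(v in L) \sum_(w in L) (v == w)%:R * (x v * x w).
    apply: eq_bigr => v vL; rewrite (bigD1 v) //= eqxx mul1r big1 ?addr0 ?expr2 //.
    by move=> w /andP[_ /negPf wv]; rewrite eq_sym wv mul0r.
  rewrite expr2 big_distrlr -!sumrN -!big_split; apply: eq_bigr => v _ /=.
  rewrite -!sumrN -!big_split; apply: eq_bigr => w _ /=; rewrite /A.
  case: (eqVneq v w) => [->|_] /=; first by rewrite irrE ?mulr1n ?mulr0n; ring.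
  by case: (E v w); rewrite /= ?mulr1n ?mulr0n; ring.
rewrite /J natr_sum big_distrl; apply: ler_sum => v vL /=.
rewrite natr_sum big_distrl; apply: ler_sum => w wL /=.
apply: ler_wpM2l; first exact: ler0n.
have H1 := xLd vL; have H2 := xLd wL.
have d1 : 0 <= 1 - delta by move: delta4 delta0; lra.
apply: le_trans (ler_pM d1 d1 H1 H2).
by move: delta4 delta0 => *; have := sqr_ge0 delta; nra.
Qed.

(** Vertices of [F] are charged [X^2] rather than [k^2]: there may be order [l^2] of them, and only
    the factor used in [split_side] lets them cancel against [t]. *)
Lemma G2_bound : G2 <= #|F|%:R * X ^+ 2 + sd2%:R.
Proof.
have ggd w : gg w <= (d w)%:R.
  rewrite /d -sum1_card natr_sum /gg big_mkcond [leRHS]big_mkcond.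
  apply: ler_sum => v _; rewrite inE /A; have := x1 v.
  by case: (v \in L); case: (E v w) => //=; rewrite ?mul1r ?mul0r.
have gg0 w : 0 <= gg w by apply: sumr_ge0 => v _; rewrite mulr_ge0.
rewrite mulr_natl -sumr_const /sd2 natr_sum /G2 big_mkcond.
rewrite [X in _ <= X + _]big_mkcond [X in _ <= _ + X]big_mkcond -big_split.
apply: ler_sum => w _ /=; rewrite !inE.
case: (boolP (w \in L)) => //= wL; first by rewrite addr0.
have dk : (d w <= k)%N.
  by rewrite -Lk; apply/subset_leq_card/subsetP => v; rewrite inE => /andP[].
case: (eqVneq (d w) k) => [dwk|dwk].
  rewrite dwk ltnn andbF addr0 ler_sqr ?nnegrE //; last by apply: sumr_ge0.
  apply: ler_sum => v _; rewrite -[leRHS]mul1r; apply: ler_wpM2r => //.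
  by rewrite /A lern1 leq_b1.
have dlt : (d w < k)%N by rewrite ltn_neqAle dwk.
rewrite add0r dlt andbT; case: posnP => [d0|dw0] /=.
  have : gg w = 0 by apply/eqP; rewrite eq_le gg0 andbT; have := ggd w; rewrite d0.
  by move=> ->; rewrite expr0n.
by rewrite natrX ler_sqr ?nnegrE.
Qed.

(** At most [C] ordered edges, with entries at most [C / l] at both ends. *)
Lemma OO_bound : l * OO <= C ^+ 3 / l.
Proof.
have C0 : 0 <= C by rewrite (le_trans _ C1).
have H : l ^+ 2 * OO <= C ^+ 3.
  apply: (@le_trans _ _ (C ^+ 2 *
     \sum_(v | v \notin L) \sum_(w | w \notin L) ((E v w)%:R : R))); last first.
    by rewrite [leRHS]exprSr; apply: ler_wpM2l; [exact: sqr_ge0|].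
  rewrite /OO !big_distrr; apply: ler_sum => v vL /=.
  rewrite !big_distrr; apply: ler_sum => w wL /=.
  have -> : l ^+ 2 * (A v w * (x v * x w)) = ((l * x v) * (l * x w)) * A v w by ring.
  apply: ler_wpM2r => //; rewrite expr2.
  by apply: ler_pM; rewrite ?mulr_ge0 ?(ltW l0) // xO.
by rewrite ler_pdivlMr // [l * OO]mulrC -mulrA -expr2 mulrC.
Qed.

Lemma count_LL : (\sum_(v in L) \sum_(w in L) E v w + J = k * k.-1)%N.
Proof.
rewrite /J -big_split /= -[X in (X * _)%N]Lk -sum_nat_const.
apply: eq_bigr => v vL; rewrite -big_split /=.
rewrite (bigD1 v) //= irrE eqxx add0n (eq_bigr (fun=> 1%N)); last first.
  by move=> w /andP[_ wv]; rewrite eq_sym wv; case: (E v w).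
rewrite sum1dep_card; have := cardsD1 v L; rewrite vL Lk.
rewrite (_ : [set w | _] = L :\ v); last by apply/setP => w; rewrite !inE andbC.
by move=> ->; rewrite add1n.
Qed.

Lemma count_edges : (2 * m = \sum_(v in L) \sum_(w in L) E v w
  + 2 * (k * #|F| + sd) + r2)%N.
Proof.
rewrite /m -handshake // (bigID (mem L)) /=.
under eq_bigr do rewrite (bigID (mem L)) /=.
rewrite big_split /=.
under [X in (_ + X)%N = _]eq_bigr do rewrite (bigID (mem L)) /=.
rewrite big_split /= -/r2.
have dE w : d w = (\sum_(v in L) E v w)%N.
  rewrite /d -sum1_card big_mkcond [RHS]big_mkcond; apply: eq_bigr => v _.
  by rewrite inE; case: (v \in L); case: (E v w).
have -> : (\sum_(v in L) \sum_(w | w \notin L) E v w = \sum_(w | w \notin L) d w)%N.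
  by rewrite exchange_big; apply: eq_bigr => w _; rewrite dE.
have -> : (\sum_(v | v \notin L) \sum_(w in L) E v w = \sum_(w | w \notin L) d w)%N.
  by apply: eq_bigr => w _; rewrite dE; apply: eq_bigr => v _; rewrite symE.
have -> : (\sum_(w | w \notin L) d w = k * #|F| + sd)%N.
  rewrite mulnC -sum_nat_const /sd big_mkcond.
  rewrite [X in (_ = X + _)%N]big_mkcond [X in (_ = _ + X)%N]big_mkcond -big_split.
  apply: eq_bigr => w _ /=; rewrite !inE.
  case: (boolP (w \in L)) => //= wL.
  have dk : (d w <= k)%N.
    by rewrite -Lk; apply/subset_leq_card/subsetP => v; rewrite inE => /andP[].
  case: (eqVneq (d w) k) => [->|dwk]; first by rewrite ltnn andbF addn0.
  have dlt : (d w < k)%N by rewrite ltn_neqAle dwk.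
  by rewrite add0n dlt andbT; case: posnP.
by rewrite mul2n -addnn !addnA.
Qed.

Lemma count_split : (2 * (k * #|F|) + 2 * sd + r2 = 2 * (k * t) + 2 * s + J)%N.
Proof.
have H : (m - 'C(k, 2) = k * t + s)%N by rewrite [(k * t)%N]mulnC; exact: divn_eq.
have H2 : ('C(k, 2) * 2 = k * k.-1)%N by have := bin_ffact k 2; rewrite ffactnS ffactn1.
exact: balance_edges km H2 H count_LL count_edges.
Qed.

Lemma endgame_isomorphic : isomorphic E (split_graph k m).
Proof.
have [Z Zs HZ] := split_side.
have [X2l X2u] := X_bounds.
have sk : (s < k)%N by rewrite /s /split_s ltn_mod.
(* [split_side] and [eigen_split] share the term [l * Q]; chaining them and multiplying by [l]
   removes it. *)
have main : l * (J%:R / 2) + (t%:R - #|F|%:R) * X ^+ 2 + Z ^+ 2 - sd2%:R - C ^+ 3 / l <= 0.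
  have H1 := le_trans HZ eigen_split.
  have H2 := ler_wpM2l (ltW l0) H1.
  have il : l * l^-1 = 1 by rewrite divff // gt_eqF.
  have e1 : l * (X ^+ 2 - Q + l^-1 * (t%:R * X ^+ 2 + Z ^+ 2)) =
    l * (X ^+ 2 - Q) + (l * l^-1) * (t%:R * X ^+ 2 + Z ^+ 2) by ring.
  have e2 : l * (LL + l^-1 * G2 + OO) = l * LL + (l * l^-1) * G2 + l * OO by ring.
  rewrite e1 e2 il !mul1r in H2.
  have H3 := ler_wpM2l (ltW l0) nonedges_weight.
  have := G2_bound; have := OO_bound; lra.
have Dd w : w \in D -> (0 < d w < k)%N by rewrite inE => /andP[].
have sd2k : (sd2 <= k * sd)%N.
  rewrite /sd2 /sd big_distrr; apply: leq_sum => w /Dd /andP[_ dk] /=.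
  by rewrite -mulnn leq_mul2r (ltnW dk) orbT.
have sdC : (sd%:R : R) <= K * (l * C).
  apply: (@le_trans _ _ (K * #|D|%:R)); last first.
    by apply: ler_wpM2l => //; rewrite (le_trans _ K1).
  rewrite /K -natrM ler_nat mulnC -sum_nat_const; apply: leq_sum => w /Dd.
  by case/andP => _ /ltnW.
have cnt : 2 * K * (t%:R - #|F|%:R) = 2 * sd%:R + r2%:R - J%:R - 2 * s%:R.
  have /(congr1 (fun n => n%:R : R)) := count_split.
  rewrite !natrD !natrM -/K; lra.
have r2C : (r2%:R : R) <= C.
  rewrite /r2 natr_sum; apply: le_trans OC; apply: ler_sum => v _.
  by rewrite natr_sum.
have Jk : (J%:R : R) <= K ^+ 2.
  rewrite /K -natrX ler_nat -mulnn (@leq_trans (k * k.-1)) //; last first.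
    by rewrite leq_mul2l leq_pred orbT.
  by rewrite -count_LL leq_addl.
have sd2k' : (sd2%:R : R) <= K * sd%:R by rewrite /K -natrM ler_nat.
have sk' : (s%:R : R) <= K by rewrite ler_nat ltnW.
have [J1 fin] := endgame_arithmetic K1 C1 (ler0n _ _) Jk (ler0n _ _) r2C
  (ler0n _ _) sk' (ler0n _ _) sdC X2u X2l Zs main cnt l1 large1 large2 sd2k'.
have J0 : J = 0%N by move: J1; rewrite -[1]/(1%:R) ltr_nat; case: (J).
have cs := count_split; rewrite J0 addn0 in cs.
(* With [J = 0] the count makes [r2] even; [r] is the number of edges outside [L]. *)
have [r r2E rE] := balance_half cs.
have defectE : (\sum_(w in D) defect k (d w) = k * sd - sd2)%N.
  apply/eqP; rewrite -(eqn_add2r sd2) subnK //; apply/eqP.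
  rewrite /sd /sd2 big_distrr -big_split; apply: eq_bigr => w /Dd /andP[_ dk] /=.
  by rewrite /defect mulnBr mulnn [(k * _)%N]mulnC subnK // -mulnn leq_mul2l (ltnW dk) orbT.
have fin' : (k * r + \sum_(w in D) defect k (d w) <= defect k s)%N.
  rewrite defectE /defect mulnBr mulnn.
  (* The error [1/4] is below [1/2], so the inequality between integers is exact. *)
  apply: ltn_double_succ.
  rewrite -(ltr_nat R) !(natrD, natrM) !natrB; last 2 first.
  - by rewrite -mulnn leq_mul2l (ltnW sk) orbT.
  - by [].
  rewrite !natrM -/K.
  move: fin; rewrite J0 r2E natrM; lra.
(* Modulo [k] the full vertices drop out of the edge count. *)
have sumE : ((sd + r) %% k = s)%N.
  by rewrite -(modnMDl #|F| (sd + r) k) mulnC rE mulnC modnMDl modn_small.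
have [r0 D1] := defect_extremal k0 Dd sumE fin'.
have r20 : r2 = 0%N by rewrite r2E r0.
have Dss w : w \in D -> D = [set w].
  move=> wD; apply/esym/eqP; rewrite eqEcard sub1set wD cards1; exact: D1.
have sdE w : w \in D -> d w = s.
  move=> wD; move: sumE; rewrite r0 addn0 /sd (Dss w wD) big_set1 modn_small //.
  by have /andP[] := Dd _ wD.
have s_pos : (0 < s)%N -> exists w, w \in D.
  move=> s0; apply/set0Pn; apply: contraTneq s0 => D0.
  by rewrite -sumE r0 /sd D0 big_set0 mod0n.
have Ft : #|F| = t.
  have sds : sd = s.
    have [D0|/set0Pn[w wD]] := eqVneq D set0.
      rewrite /sd D0 big_set0; apply/esym/eqP; rewrite -leqn0 leqNgt.
      by apply/negP => /s_pos[w]; rewrite D0 inE.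
    by rewrite /sd (Dss w wD) big_set1 sdE.
  by move/eqP: rE; rewrite r0 addn0 sds eqn_add2r eqn_pmul2l // => /eqP.
have FE w : w \in F -> w \notin L /\ d w = k by rewrite inE => /andP[? /eqP].
pose S0 := [set v in L | [exists w in D, E v w]].
apply: (@split_graph_recognition V E k m L F D S0) => //.
- by apply/subsetP => v; rewrite inE => /andP[].
- rewrite -/s; have [D0|/set0Pn[w wD]] := eqVneq D set0.
    have -> : S0 = set0.
      by apply/setP => v; rewrite !inE; apply/negbTE/nandP; right; apply/exists_inPn => w; rewrite D0 inE.
    rewrite cards0; apply/esym/eqP; rewrite -leqn0 leqNgt; apply/negP => /s_pos[w].
    by rewrite D0 inE.
  rewrite -(sdE w wD) /d; apply: eq_card => v; rewrite !inE; congr (_ && _).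
  apply/exists_inP/idP => [[w' ]|vw]; last by exists w.
  by rewrite (Dss w wD) inE => /eqP ->.
- by move=> w /FE[].
- by move=> w wD; have := wD; rewrite !inE => /and3P[-> _ dk] /=; rewrite (ltn_eqF dk).
- by move=> w w' wD; rewrite (Dss w wD) inE => /eqP.
- move=> v w vL wL; case: (eqVneq v w) => [->|vw]; first by rewrite irrE.
  move/eqP: J0; rewrite /J sum_nat_eq0 => /forall_inP/(_ v vL).
  rewrite sum_nat_eq0 => /forall_inP/(_ w wL); rewrite vw /=; by case: (E v w).
- move=> v w vL /FE[wL dk].
  have : [set v in L | E v w] = L.
    by apply/eqP; rewrite eqEcard Lk -dk leqnn andbT; apply/subsetP => z; rewrite inE => /andP[].
  by move/setP/(_ v); rewrite inE vL.
- move=> v w vL wD; rewrite inE vL /=; apply/idP/exists_inP => [vw|[w']]; first by exists w.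
  by rewrite (Dss w wD) inE => /eqP ->.
- move=> v w vL wL; move/eqP: r20; rewrite /r2 sum_nat_eq0 => /forall_inP/(_ v vL).
  by rewrite sum_nat_eq0 => /forall_inP/(_ w wL); case: (E v w).
move=> w wL /existsP[v wv]; rewrite !inE wL /=.
have vL : v \in L.
  apply/negPn/negP => vL; move/eqP: r20; rewrite /r2 sum_nat_eq0 => /forall_inP/(_ v vL).
  by rewrite sum_nat_eq0 => /forall_inP/(_ w wL); rewrite symE wv.
have dw : (0 < d w)%N by apply/card_gt0P; exists v; rewrite inE vL symE.
rewrite dw /= orbC ltn_neqAle.
have -> : (d w <= k)%N.
  by rewrite -Lk; apply/subset_leq_card/subsetP => z; rewrite inE => /andP[].
by rewrite andbT orNb.
Qed.

End Endgame.

(** * Forbidden bipartite graphs *)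

(** The default [#|V|] of the minimum bounds any class; if the smaller class has colour [false], the
    colours are swapped. *)
Lemma small_color_class (V : finType) (E : rel V) : bipartite E ->
  exists2 c : {ffun V -> bool}, proper2 E c &
    (#|[set x | nonisol E x & c x]| <= sigma E)%N.
Proof.
case=> c0 pc0.
pose P (n : nat) := exists2 c : {ffun V -> bool}, proper2 E c &
  (#|[set x | nonisol E x & c x]| <= n)%N.
rewrite -/(P _) /sigma; apply: (big_ind P).
- by exists c0 => //; exact: max_card.
- by move=> n1 n2 H1 H2; rewrite /minn; case: ifP.
move=> c pc; rewrite /minn; case: ifP => _; first by exists c.
exists [ffun x => ~~ c x].
  apply/forallP => x; apply/forallP => y; apply/implyP => xy; rewrite !ffunE.
  move/forallP/(_ x)/forallP/(_ y)/implyP/(_ xy): pc.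
  by case: (c x); case: (c y).
by rewrite (_ : [set x | _ & _] = [set x | nonisol E x & ~~ c x]) //; apply/setP => x; rewrite !inE ffunE.
Qed.

Lemma proper2_edge (V : finType) (E : rel V) (c : {ffun V -> bool}) x y :
  symmetric E -> proper2 E c -> E x y -> [/\ nonisol E x, nonisol E y & c y = ~~ c x].
Proof.
move=> symE pc xy; split; first by apply/existsP; exists y.
  by apply/existsP; exists x; rewrite symE.
move/forallP/(_ x)/forallP/(_ y)/implyP/(_ xy): pc.
by case: (c x); case: (c y).
Qed.

(** A colour class meets every edge, so a one-vertex class is the centre of a star; with an empty
    class there are no edges and any vertex is a centre. *)
Lemma not_star_sigma_gt1 (V : finType) (E : rel V) : (0 < #|V|)%N ->
  symmetric E -> bipartite E -> ~ is_star E -> (1 < sigma E)%N.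
Proof.
move=> V0 symE bip nstar; rewrite ltnNge; apply/negP => s1; apply: nstar.
have [c pc /leq_trans/(_ s1) c1] := small_color_class bip.
set A := [set x | _ & _] in c1.
have cover x y : E x y -> (x \in A) || (y \in A).
  by move=> /(proper2_edge symE pc)[nx ny cy]; rewrite !inE nx ny cy /=; case: (c x).
have [A0|/set0Pn[v vA]] := eqVneq A set0.
  have [v _] := card_gt0P V0; exists v => x y /cover; by rewrite A0 !inE.
have Av : A = [set v] by apply/esym/eqP; rewrite eqEcard sub1set vA cards1.
by exists v => x y /cover; rewrite Av !inE => /orP[]/eqP; [left|right].
Qed.

(** The small colour class goes into [U] and all other vertices, isolated ones included, into the
    common neighbourhood; hence the size [#|VF|]. *)
Lemma F_free_biclique_free (VF : finType) (EF : rel VF) (V : finType) (E : rel V) :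
  (0 < #|VF|)%N -> symmetric EF -> bipartite EF -> simple_graph E ->
  F_free EF E -> biclique_free E (sigma EF) #|VF|.
Proof.
move=> VF0 symF bip [symE irrE] Ffree U Us; rewrite ltnNge; apply/negP => big.
apply: Ffree; have [c pc cs] := small_color_class bip.
set A := [set x | _ & _] in cs; set B := common_nbrs E U in big.
have [u0 _] : exists u, u \in B by apply/card_gt0P; exact: leq_trans big.
pose f x := if x \in A then nth u0 (enum U) (index x (enum A))
            else nth u0 (enum B) (index x (enum VF)).
have iA x : x \in A -> (index x (enum A) < size (enum U))%N.
  by move=> xA; rewrite -cardE Us (leq_trans _ cs) // cardE index_mem mem_enum.
have iV x : (index x (enum VF) < size (enum B))%N.
  by rewrite -cardE (leq_trans _ big) // cardE index_mem mem_enum.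
have fA x : x \in A -> f x \in U.
  by move=> xA; rewrite /f xA -mem_enum mem_nth // iA.
have fB x : x \notin A -> f x \in B.
  by move=> /negPf xA; rewrite /f xA -mem_enum mem_nth // iV.
have UB x y : x \in A -> y \notin A -> E (f x) (f y).
  by move=> xA yA; move/common_nbrsP: (fB _ yA); apply; exact: fA.
exists f; split=> [x y _ _|x y xy].
  case: (boolP (x \in A)) => xA; case: (boolP (y \in A)) => yA.
  - rewrite /f xA yA => /eqP; rewrite nth_uniq ?enum_uniq ?iA // => /eqP H.
    rewrite -(nth_index x (_ : x \in enum A)) ?mem_enum // H nth_index //.
    by rewrite mem_enum.
  - by move=> e; have := UB _ _ xA yA; rewrite e irrE.
  - by move=> e; have := UB _ _ yA xA; rewrite e irrE.
  rewrite /f (negPf xA) (negPf yA) => /eqP; rewrite nth_uniq ?enum_uniq ?iV // => /eqP H.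
  by rewrite -(nth_index x (_ : x \in enum VF)) ?mem_enum // H nth_index // mem_enum.
have [nx ny cy] := proper2_edge symF pc xy.
have xE : (x \in A) = c x by rewrite inE nx.
have yE : (y \in A) = ~~ c x by rewrite inE ny cy.
case: (boolP (x \in A)) => xA; first by apply: UB => //; rewrite yE -xE xA.
by rewrite symE; apply: UB; rewrite // yE -xE.
Qed.

(** * The extremal graph for large [m] *)

Lemma split_remainder_bound k m : (0 < k)%N -> ('C(k, 2) <= m)%N ->
  (m <= k * split_t k m + k ^ 2)%N.
Proof.
move=> k0 km.
have H : (m - 'C(k, 2) = k * split_t k m + split_s k m)%N.
  by rewrite [(k * _)%N]mulnC; exact: divn_eq.
have : ('C(k, 2) * 2 = k * k.-1)%N by have := bin_ffact k 2; rewrite ffactnS ffactn1.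
have : (split_s k m < k)%N by rewrite /split_s ltn_mod.
move: H km; set t := split_t k m; set s := split_s k m; set c := 'C(k, 2).
by case: k k0 @t @s @c => // k _ t s c; rewrite -mulnn /=; nia.
Qed.

(** A weak inequality between the radii already forces isomorphism, which yields both the bound and
    its equality case. *)
Lemma extremal_isomorphic (R : realType) (k b : nat) : (0 < k)%N ->
  exists M : nat, forall m : nat, (M <= m)%N ->
  forall (V : finType) (E : rel V), simple_graph E -> nedges E = m ->
  biclique_free E k.+1 b -> lambda R (split_graph k m) <= lambda R E ->
  isomorphic E (split_graph k m).
Proof.
move=> k0; have [C C1 stab] := stability R b k0.
pose K : R := k%:R.
have K0 : 0 <= K by exact: ler0n.
have C0 : 0 <= C by exact: le_trans C1.
pose C2 : R := 4 * (2 * K ^+ 2 * C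
  + 2 * K ^+ 2 * C * (2 * K * C + C + K ^+ 2 + 2 * K) + C ^+ 3).
have C20 : 0 <= C2.
  by rewrite /C2 mulr_ge0 // !addr_ge0 ?mulr_ge0 ?addr_ge0 ?mulr_ge0 ?exprn_ge0.
pose B : R := C + (K + 2 * K ^+ 2 + 1) + C2.
have K20 : 0 <= K ^+ 2 by rewrite exprn_ge0.
have B0 : 0 <= B by rewrite /B; lra.
(* [m >= 2 k^2] gives [m <= 2 l^2], and then [m >= 2 B^2] gives [l >= B]. *)
exists (Num.bound (2 * B ^+ 2) + 2 * k ^ 2 + 'C(k, 2) + 1)%N.
move=> m Mm V E gE Em free lam; set l := lambda R E in lam.
have [symE irrE] := gE.
have mB : 2 * B ^+ 2 <= (m%:R : R).
  have H : 0 <= 2 * B ^+ 2 by rewrite mulr_ge0 // exprn_ge0.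
  by apply: le_trans (ltW (archi_boundP H)) _; rewrite ler_nat; lia.
have mk : (2 * k ^ 2 <= m)%N by lia.
have km : ('C(k, 2) <= m)%N by lia.
have m0 : (0 < m)%N by lia.
have hs : \sum_v \sum_w ((E v w)%:R : R) = 2 * m%:R.
  rewrite -Em -natrM -handshake // natr_sum; apply: eq_bigr => v _; by rewrite natr_sum.
have m0R : 0 < (m%:R : R) by rewrite ltr0n.
have V0 : (0 < #|V|)%N.
  rewrite lt0n; apply/eqP => /card0_eq V0.
  by move: hs; rewrite big_pred0 => [|v]; [lra | have := V0 v].
have [psd [y [y0 [v0 yv0] ey]]] := spectral_radius_perron R symE V0.
rewrite -/l in psd ey.
have l0 : 0 < l.
  rewrite lt_def lambda_ge0 // andbT; apply/eqP => l00.
  have := psd (fun=> 1); rewrite l00 mul0r /qform.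
  under eq_bigr do under eq_bigr do rewrite !mulr1.
  by rewrite hs; lra.
have low := split_lambda_lower k0 lam l0.
have lowm : (m%:R : R) - (k ^ 2)%:R <= l ^+ 2 - k.-1%:R * l.
  apply: le_trans low; rewrite lerBlDr -natrD ler_nat.
  exact: split_remainder_bound.
have kl : 0 <= k.-1%:R * l by rewrite mulr_ge0 // ltW.
have ml : (m%:R : R) <= 2 * l ^+ 2.
  have : 2 * (k ^ 2)%:R <= (m%:R : R) by rewrite -natrM ler_nat.
  by move: lowm kl; lra.
have Bl : B <= l.
  by rewrite -ler_sqr ?nnegrE // ?(ltW l0) //; lra.
pose u := [arg max_(v > v0) y v]%O.
have yu v : y v <= y u by rewrite /u; case: arg_maxP => // w _; apply.
have yu0 : 0 < y u by exact: lt_le_trans (yu v0).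
pose x v := y v / y u.
have ex v : apply_form (fun v w => (E v w)%:R) x v = l * x v.
  rewrite /x mulrA -ey /apply_form big_distrl; apply: eq_bigr => w _ /=.
  by rewrite mulrA.
have x01 v : 0 <= x v <= 1.
  by rewrite /x divr_ge0 ?(ltW yu0) //= ler_pdivrMr // mul1r.
have xu : x u = 1 by rewrite /x divff // gt_eqF.
have Cl : C <= l by apply: le_trans Bl; rewrite /B; lra.
have [||L [Lk xL xO OC DC]] := stab V E x l u gE free ex x01 xu Cl; rewrite ?Em //.
have := @endgame_isomorphic R V E k L x l C symE irrE k0 Lk ex.
rewrite Em; apply=> //.
- by move=> v; have /andP[] := x01 v.
- by move=> v; have /andP[] := x01 v.
- exact: le_trans Cl.
- by apply: le_trans Bl; rewrite -/K /B; lra.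
- by apply: le_trans Bl; rewrite -/K -/C2 /B; lra.
Qed.

Theorem theorem1p14 (R : realType) (VF : finType) (EF : rel VF) :
  simple_graph EF -> bipartite EF -> ~ is_star EF ->
  sigma EF = (order_g EF - alpha EF)%N ->
  exists M : nat, forall m : nat, (M <= m)%N ->
    forall (V : finType) (E : rel V),
      simple_graph E -> nedges E = m -> F_free EF E ->
      lambda R E <= lambda R (split_graph (sigma EF).-1 m) /\
      (lambda R E = lambda R (split_graph (sigma EF).-1 m) <->
       isomorphic E (split_graph (sigma EF).-1 m)).
Proof.
move=> [symF irrF] bip nstar _.
have [VF0|VF0] := posnP #|VF|.
  (* A graph on no vertices lacks a centre and so is not a star, but it embeds in every graph. *)
  exists 0%N => m _ V E _ _ Ffree; case: Ffree.
  have no (x : VF) : False by have := card0_eq VF0 x.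
  by exists (fun x => match no x with end); split=> x; case: (no x).
have s1 := not_star_sigma_gt1 VF0 symF bip nstar.
have k0 : (0 < (sigma EF).-1)%N by rewrite -ltnS prednK // ltnW.
have [M HM] := extremal_isomorphic R #|VF| k0.
exists M.+1 => m Mm V E gE Em Ffree; have [symE irrE] := gE.
have free : biclique_free E (sigma EF).-1.+1 #|VF|.
  by rewrite prednK ?(ltnW s1) //; exact: F_free_biclique_free.
have iso := HM m (ltnW Mm) V E gE Em free.
have V0 : (0 < #|V|)%N.
  rewrite lt0n; apply/eqP => /card0_eq V0; move: Mm; rewrite -Em ltnNge.
  have := handshake gE; rewrite big_pred0 => [|v]; last by have := V0 v.
  by move/eqP; rewrite eq_sym muln_eq0 /= => /eqP ->.
have iso_eq := @lambda_isomorphic R V _ E _ symE (@split_graph_sym _ m) V0.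
split; last by split=> [eq_l|/iso_eq //]; apply: iso; rewrite eq_l.
(* A strictly larger radius would give an isomorphism, hence equal radii. *)
rewrite leNgt; apply/negP => lt_l.
by move: (lt_l); rewrite (iso_eq _ (iso (ltW lt_l))) ltxx.
Qed.
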